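(* Let $\lambda$ be a partition with $\ell(\lambda)$ parts, and let $\mathsf{CS}(\lambda)_{\ell(\lambda)}$ be the induced subgraph of $\mathsf{CS}(\lambda)$ on the vertices $T$ with $\mathsf{Des}(T)$ having exactly $\ell(\lambda)$ parts. Then $\mathsf{CS}(\lambda)_{\ell(\lambda)}$ is isomorphic to the crystal graph $B(\lambda)_{\ell(\lambda)}$. Under this isomorphism, a vertex $T$ with $\alpha=\mathsf{Des}(T)$ is mapped to the tableau $b$ obtained from $T$ by replacing every entry of $\alpha^{(i)}$ by $i$ (for all $i$), so that $\mathsf{Des}(T)$ becomes the weight of $b$; and an edge $T\xrightarrow{I}T'$ with $I=[i,i+2m]$, $I^-=[i,i+m-1]$, $I^+=[i+m+1,i+2m]$, $I^-\cup\{i+m\}\subseteq\alpha^{(j)}$ and $I^+\subseteq\alpha^{(j+1)}$ becomes the crystal edge $b\xrightarrow{j}b'$, i.e. $b'=f_j(b)$.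
   Context: French notation; $|\lambda|=N$; $\mathsf{SYT}(\lambda)$ standard tableaux; $\mathsf{SSYT}(\lambda)_n$ semistandard tableaux with entries in $[n]$; $\mathsf{row}(b)$ reads rows left to right from top row to bottom row; $\mathsf{std}$ replaces the $a_j$ entries $j$, in reading order, by $a_1+\dots+a_{j-1}+1,\dots,a_1+\dots+a_j$. The crystal graph $B(\lambda)_n$ has vertex set $\mathsf{SSYT}(\lambda)_n$ and edges $b\xrightarrow{j}f_j(b)$, where in the subword of $\mathsf{row}(b)$ of letters $j,j+1$ each $j+1$ is bracketed with an unbracketed $j$ to its right (parenthesis matching) and $f_j$ changes the rightmost unbracketed $j$ to $j+1$ (no edge if none); the weight of $b$ is $(a_1,\dots,a_n)$ with $a_j$ the number of entries $j$. For a permutation $\pi$ of $[N]$ and $I=[i,i+2m]\subseteq[N]$, $m\ge1$, $I$ is a Dyck pattern interval of $\pi$ if the RSK insertion tableau of the subword $\pi|_I$ has bottom row $i,\dots,i+m$ and top row $i+m+1,\dots,i+2m$; a Dyck pattern interval of $T$ is one of $\mathsf{row}(T)$. The crystal skeleton $\mathsf{CS}(\lambda)$ is the directed graph on $\mathsf{SYT}(\lambda)$ with, for each Dyck pattern interval $I=[i,i+2m]$ of $T$, an edge $T\xrightarrow{I}\mathsf{std}(f_i(c))$, $c$ obtained from $T$ by replacing entries $i,\dots,i+m$ by $i$ and $i+m+1,\dots,i+2m$ by $i+1$. Descent composition: $d$ is a descent of $T$ if $d+1$ lies in a strictly higher row; for descents $d_1<\dots<d_k$, $\mathsf{Des}(T)=(d_1,d_2-d_1,\dots,N-d_k)$;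 for a composition $\alpha$, $\alpha^{(j)}=\{\alpha_1+\dots+\alpha_{j-1}+1,\dots,\alpha_1+\dots+\alpha_j\}$. *)

(* Defs.v *)
(* Tableaux are seq (seq nat), listed row by row from the
   BOTTOM row (row 0, longest) upwards: French notation. *)
From mathcomp Require Import all_boot.
Set Implicit Arguments. Unset Strict Implicit. Unset Printing Implicit Defensive.

Definition tableau := seq (seq nat).

Definition is_partition (lam : seq nat) : bool :=
  sorted geq lam && all (fun p => 0 < p) lam.

Definition shape (t : tableau) : seq nat := map size t.

Definition is_ssyt (t : tableau) : bool :=
  all (sorted leq) t &&
  all (fun r => all (fun c => nth 0 (nth [::] t r) c < nth 0 (nth [::] t r.+1) c)
                    (iota 0 (size (nth [::] t r.+1))))
      (iota 0 (size t)).

Definition is_SSYT (lam : seq nat) (n : nat) (b : tableau) : bool :=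
  [&& shape b == lam, is_ssyt b & all (fun x => 0 < x <= n) (flatten b)].

Definition is_SYT (lam : seq nat) (T : tableau) : bool :=
  [&& shape T == lam, is_ssyt T & perm_eq (flatten T) (iota 1 (sumn lam))].

Definition rowword (t : tableau) : seq nat := flatten (rev t).

Definition tab_of_word (sh : seq nat) (w : seq nat) : tableau :=
  rev (reshape (rev sh) w).

(* crystal operator f_j on words: letters j+1 are '(' and letters j are ')';
   f_j changes the rightmost unbracketed j into j+1. *)
Fixpoint fpos (j : nat) (w : seq nat) (i open : nat) (best : option nat)
  : option nat :=
  match w with
  | [::] => best
  | x :: w' =>
      if x == j.+1 then fpos j w' i.+1 open.+1 best
      else if x == j then
        (if open is k.+1 then fpos j w' i.+1 k best
         else fpos j w' i.+1 0 (Some i))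
      else fpos j w' i.+1 open best
  end.

Definition f_word (j : nat) (w : seq nat) : option (seq nat) :=
  omap (fun p => set_nth 0 w p j.+1) (fpos j w 0 0 None).

Definition f_tab (j : nat) (t : tableau) : option tableau :=
  omap (tab_of_word (shape t)) (f_word j (rowword t)).

Definition std_word (w : seq nat) : seq nat :=
  [seq count (fun y => y < nth 0 w p) w + count (pred1 (nth 0 w p)) (take p.+1 w)
  | p <- iota 0 (size w)].

Definition std_tab (t : tableau) : tableau :=
  tab_of_word (shape t) (std_word (rowword t)).

(* RSK row insertion; rows listed bottom first (French), so the first row
   is the bottom row. *)
Fixpoint ins_rows (t : tableau) (x : nat) : tableau :=
  match t with
  | [::] => [:: [:: x]]
  | r :: t' =>
      let k := find (fun y => x < y) r in
      if k < size r then set_nth 0 r k x :: ins_rows t' (nth 0 r k)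
      else rcons r x :: t'
  end.

Definition rsk_P (w : seq nat) : tableau := foldl ins_rows [::] w.

Definition dyck_interval (pi : seq nat) (i m : nat) : bool :=
  [&& 0 < m, 0 < i, i + 2 * m <= size pi &
   rsk_P [seq x <- pi | i <= x <= i + 2 * m] == [:: iota i m.+1; iota (i + m).+1 m]].

Definition collapse (i m : nat) (T : tableau) : tableau :=
  map (map (fun x => if i <= x <= i + m then i
                     else if i + m < x <= i + 2 * m then i.+1 else x)) T.

Definition cs_edge (T : tableau) (i m : nat) (T' : tableau) : Prop :=
  dyck_interval (rowword T) i m /\
  exists2 b, f_tab i (collapse i m T) = Some b & std_tab b = T'.

Definition row_of (T : tableau) (v : nat) : nat := find (fun r => v \in r) T.

Definition descents (T : tableau) : seq nat :=
  [seq d <- iota 1 (sumn (shape T)).-1 | row_of T d < row_of T d.+1].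

Definition Des (T : tableau) : seq nat :=
  let N := sumn (shape T) in
  let D := descents T in
  if N == 0 then [::]
  else [seq p.2 - p.1 | p <- zip (0 :: D) (rcons D N)].

(* alpha^(j) for 1 <= j <= size alpha *)
Definition block (alpha : seq nat) (j : nat) : seq nat :=
  iota (sumn (take j.-1 alpha)).+1 (nth 0 alpha j.-1).

Definition block_index (alpha : seq nat) (x : nat) : nat :=
  (find (fun j => x \in block alpha j) (iota 1 (size alpha))).+1.

Definition phi (T : tableau) : tableau :=
  map (map (block_index (Des T))) T.

Definition CSvert (lam : seq nat) : pred tableau :=
  [pred T | is_SYT lam T && (size (Des T) == size lam)].

Definition Bvert (lam : seq nat) : pred tableau :=
  [pred b | is_SSYT lam (size lam) b].

(* Main.v *)
(** Replacing the entries of [T] by the indices of their blocks of [Des T] is inverted by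
    standardization: a semistandard tableau with [l] rows and entries at most [l] has first
    column [1, ..., l], so every letter occurs and the first [j.+1] of the reading word precedes
    every [j]; hence the descents of its standardization are exactly the ends of the blocks.

    Row insertion preserves the relative order of consecutive values, so a Dyck pattern interval
    [[i, i + 2m]] contains a single descent [i + m] and lies in two consecutive blocks [j], [j.+1].
    The collapsed word is the [j], [j.+1] word of [phi T] restricted to its last [m + 1] letters
    [j] and first [m] letters [j.+1].  The rightmost unbracketed letters of the two words are at the
    same position unless a letter [j.+1] outside the interval precedes it, and in that case the edge
    creates an additional descent.  Conversely, if [f_j] acts at position [p], the interval is
    recovered with [m] the number of letters [j.+1] before [p] plus the number of letters [j]
    after [p]. *)
Require Import Defs.
From mathcomp Require Import all_boot.
From mathcomp Require Import zify.
Set Implicit Arguments. Unset Strict Implicit. Unset Printing Implicit Defensive.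

(** * Counting on intervals, and words that are permutations of [[1, N]] *)

Lemma count_nth_iota (P : pred nat) (w : seq nat) :
  count P w = count (fun q => P (nth 0 w q)) (iota 0 (size w)).
Proof. by rewrite -[in LHS](mkseq_nth 0 w) /mkseq count_map. Qed.

(** A down-closed predicate holds on an initial segment, so its count is the cutoff. This turns
    blocks, and the letters lying before a given position, into intervals of values. *)
Lemma count_downclosed (P : pred nat) lo n :
  (forall x y, lo <= x <= y -> y < lo + n -> P y -> P x) ->
  forall x, lo <= x < lo + n -> P x = (x < lo + count P (iota lo n)).
Proof.
elim: n => [|n IHn] Pdown x; first by lia.
have Pdown' y z : lo <= y <= z -> z < lo + n -> P z -> P y.
  by move=> h1 h2; apply: Pdown => //; lia.
rewrite -[n.+1]addn1 iotaD count_cat /= addn0 => hx.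
case Pn: (P (lo + n)); last first.
  rewrite addn0; have [->|hxn] := eqVneq x (lo + n).
    by rewrite Pn; have := count_size P (iota lo n); rewrite size_iota; lia.
  by apply: IHn => //; lia.
have -> : P x by apply: Pdown Pn; lia.
have -> : count P (iota lo n) = n; last by lia.
rewrite -[RHS](size_iota lo); apply/eqP; rewrite -all_count; apply/allP => y.
by rewrite mem_iota => hy; apply: Pdown Pn; lia.
Qed.

Lemma count_lt_exists (T : eqType) (P Q : pred T) s x :
  x \in s -> subpred P Q -> Q x -> ~~ P x -> count P s < count Q s.
Proof.
move=> xs PQ Qx nPx.
have -> : count Q s = count P s + count [predD Q & P] s.
  rewrite -count_predUI [X in _ + X](_ : _ = 0) ?addn0.
    apply: eq_count => y /=; case Py: (P y) => /=; first exact: PQ.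
    by rewrite !unfold_in Py.
  apply/eqP; rewrite eqn0Ngt -has_count; apply/hasP => -[y _ /=].
  by rewrite !unfold_in; case: (P y).
rewrite -[X in X < _]addn0 ltn_add2l -has_count; apply/hasP; exists x => //=.
by rewrite !unfold_in nPx.
Qed.

Section PermWords.

Variables (N : nat) (w : seq nat).
Hypothesis w_perm : perm_eq w (iota 1 N).

Lemma mem_perm_iota x : (x \in w) = (0 < x <= N).
Proof. by rewrite (perm_mem w_perm) mem_iota; lia. Qed.

Lemma size_perm_iota : size w = N.
Proof. by rewrite (perm_size w_perm) size_iota. Qed.

Lemma uniq_perm_iota : uniq w.
Proof. by rewrite (perm_uniq w_perm) iota_uniq. Qed.

Lemma nth_perm_iota p : p < N -> 0 < nth 0 w p <= N.
Proof. by move=> hp; rewrite -mem_perm_iota mem_nth // size_perm_iota. Qed.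

Lemma index_perm_lt x : 0 < x <= N -> index x w < N.
Proof. by move=> hx; rewrite -[X in _ < X]size_perm_iota index_mem mem_perm_iota. Qed.

Lemma nth_index_perm x : 0 < x <= N -> nth 0 w (index x w) = x.
Proof. by move=> hx; rewrite nth_index // mem_perm_iota. Qed.

Lemma index_nth_perm p : p < N -> index (nth 0 w p) w = p.
Proof. by move=> hp; rewrite index_uniq ?size_perm_iota ?uniq_perm_iota. Qed.

Lemma index_perm_inj x y :
  0 < x <= N -> 0 < y <= N -> index x w = index y w -> x = y.
Proof. by move=> hx hy h; rewrite -(nth_index_perm hx) h nth_index_perm. Qed.

End PermWords.

(** * Standardization *)

(** The order in which standardization numbers positions: by letter, then from left to right. *)
Definition lexle (v : seq nat) (q p : nat) : bool :=
  (nth 0 v q < nth 0 v p) || (nth 0 v q == nth 0 v p) && (q <= p).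

Lemma size_std_word v : size (std_word v) = size v.
Proof. by rewrite size_map size_iota. Qed.

Lemma nth_std_word v p : p < size v ->
  nth 0 (std_word v) p = count (fun q => lexle v q p) (iota 0 (size v)).
Proof.
move=> hp; rewrite (nth_map 0) ?size_iota // nth_iota // add0n.
set a := nth 0 v p.
have -> : count (pred1 a) (take p.+1 v)
          = count (fun q => (nth 0 v q == a) && (q <= p)) (iota 0 (size v)).
  have -> : size v = p.+1 + (size v - p.+1) by lia.
  rewrite iotaD count_cat add0n [X in _ + X](_ : _ = 0) ?addn0; last first.
    apply/eqP; rewrite eqn0Ngt -has_count; apply/hasP => -[q].
    by rewrite mem_iota; lia.
  rewrite [LHS]count_nth_iota size_takel //.
  apply: eq_in_count => q; rewrite mem_iota add0n => /andP[_ hq] /=.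
  by rewrite nth_take // -ltnS hq andbT.
rewrite count_nth_iota -count_predUI [X in _ + X](_ : _ = 0) ?addn0 //.
by apply/eqP; rewrite eqn0Ngt -has_count; apply/hasP => -[q _ /=]; lia.
Qed.

Lemma lexle_trans v : transitive (lexle v).
Proof. by move=> b a c; rewrite /lexle; lia. Qed.

Lemma lexleNge v p q : ~~ lexle v q p -> lexle v p q.
Proof. by rewrite /lexle; lia. Qed.

Lemma lexle_anti v p q : p != q -> lexle v q p = ~~ lexle v p q.
Proof. by rewrite /lexle; lia. Qed.

Lemma eq_std_word v v' : size v = size v' ->
  (forall p q, p < size v -> q < size v -> lexle v q p = lexle v' q p) ->
  std_word v = std_word v'.
Proof.
move=> eqs H; apply: (@eq_from_nth _ 0); rewrite !size_std_word // => p hp.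
rewrite !nth_std_word -?eqs //; apply: eq_in_count => q.
by rewrite mem_iota => hq; apply: H; lia.
Qed.

(** [std_word] gives ranks for the total order [lexle]. If [q] is not below [p], all positions below
    [p] are below [q], and [q] itself makes the inclusion strict. *)
Lemma std_word_le v p q : p < size v -> q < size v ->
  (nth 0 (std_word v) q <= nth 0 (std_word v) p) = lexle v q p.
Proof.
move=> hp hq; rewrite !nth_std_word //.
have [le_qp|nle_qp] := boolP (lexle v q p).
  by apply: sub_count => r /= /lexle_trans; apply.
apply/negbTE; rewrite -ltnNge; apply: (@count_lt_exists _ _ _ _ q) => //.
- by rewrite mem_iota; lia.
- by move=> r /= /lexle_trans; apply; apply: lexleNge.
- by rewrite /= /lexle; lia.
Qed.

Lemma std_word_perm v : perm_eq (std_word v) (iota 1 (size v)).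
Proof.
have u : uniq (std_word v).
  apply/(uniqP 0) => p q; rewrite !inE size_std_word => hp hq epq.
  have h1 := std_word_le hp hq; have h2 := std_word_le hq hp.
  rewrite epq leqnn in h1; rewrite epq leqnn in h2.
  by move: h1 h2; rewrite /lexle; lia.
apply: uniq_perm => //; first exact: iota_uniq.
have sub : {subset std_word v <= iota 1 (size v)}.
  move=> x /(nthP 0)[p]; rewrite size_std_word => hp <-.
  rewrite mem_iota nth_std_word // -has_count; apply/andP; split.
    by apply/hasP; exists p; rewrite ?mem_iota /lexle; lia.
  have := count_size (fun q => lexle v q p) (iota 0 (size v)); rewrite size_iota; lia.
by have [] := uniq_min_size u sub; rewrite ?size_std_word ?size_iota.
Qed.

(** The value of a permutation of [[1, N]] at [p] is the number of values that do not exceed it,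
    which is the rank of [p]. So the order induced on positions determines the permutation. *)
Lemma std_wordP N v w : perm_eq w (iota 1 N) -> size v = N ->
  (forall p q, p < N -> q < N -> lexle v q p = (nth 0 w q <= nth 0 w p)) ->
  std_word v = w.
Proof.
move=> wp sv H; have sw := size_perm_iota wp.
apply: (@eq_from_nth _ 0); rewrite size_std_word ?sv // => p hp.
rewrite nth_std_word ?sv //.
have := nth_perm_iota wp hp; set a := nth 0 w p => ha.
have -> : count (fun q => lexle v q p) (iota 0 N) = count (fun y => y <= a) w.
  rewrite [RHS]count_nth_iota sw; apply: eq_in_count => q; rewrite mem_iota => hq.
  by rewrite H //; lia.
rewrite (permP wp).
have -> : N = a + (N - a) by lia.
rewrite iotaD count_cat (_ : count _ (iota (1 + a) _) = 0); last first.
  by apply/eqP; rewrite eqn0Ngt -has_count; apply/hasP => -[q]; rewrite mem_iota; lia.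
rewrite addn0 -[RHS](size_iota 1); apply/eqP; rewrite -all_count; apply/allP => q.
by rewrite mem_iota; lia.
Qed.

(** * Descents and blocks *)

(** A descent read off the word alone: higher rows are read first. [row_of_desw] matches it with the
    tableau. *)
Definition desw (w : seq nat) (d : nat) : bool := index d.+1 w < index d w.

(* [bi w x] is the index of the block of the descent composition containing [x]. *)
Definition bi (w : seq nat) (x : nat) : nat := (count (desw w) (iota 1 x.-1)).+1.

Lemma biS w x : 0 < x -> bi w x.+1 = bi w x + desw w x.
Proof.
case: x => // x _; rewrite /bi !succnK; have -> : iota 1 x.+1 = iota 1 x ++ [:: x.+1].
  by rewrite -[in LHS](addn1 x) iotaD add1n.
by rewrite count_cat /= addn0 addSn.
Qed.

Lemma bi_gt0 w x : 0 < bi w x. Proof. by []. Qed.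

Lemma bi_homo w x y : 0 < x -> x <= y -> bi w x <= bi w y.
Proof.
move=> x0 xy; rewrite -(subnK xy); elim: (y - x) => // k IHk.
by rewrite addSn biS; lia.
Qed.

(** A constant block index excludes descents between [x] and [y], so each step moves weakly to the
    right. *)
Lemma bi_eq_index_le w x y :
  0 < x <= y -> bi w x = bi w y -> index x w <= index y w.
Proof.
case/andP=> x0 xy; rewrite -(subnK xy); elim: (y - x) => // k IHk.
rewrite addSn biS; last by lia.
have := @bi_homo w x (k + x) x0 (leq_addl _ _).
case E: (desw w (k + x)); first by lia.
rewrite addn0 => _ /IHk h; apply: leq_trans h _.
by move: E; rewrite /desw; lia.
Qed.

Section BlocksOfPerm.

Variables (N : nat) (w : seq nat).
Hypothesis w_perm : perm_eq w (iota 1 N).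

Lemma bi_eq_index x y :
  0 < x -> x < y <= N -> bi w x = bi w y -> index x w < index y w.
Proof.
move=> x0 xy e; rewrite ltn_neqAle bi_eq_index_le // ?andbT; last by lia.
by apply/eqP => /(index_perm_inj w_perm); lia.
Qed.

(** When [g] is weakly increasing and the values it identifies occur from left to right, breaking
    ties by position restores the order of [w]. This serves both for block indices and for the
    collapse of a window. *)
Lemma lexle_map (g : nat -> nat) :
  (forall x y, 0 < x -> x < y <= N -> g x <= g y) ->
  (forall x y, 0 < x -> x < y <= N -> g x = g y -> index x w < index y w) ->
  forall p q, p < N -> q < N ->
  lexle (map g w) q p = (nth 0 w q <= nth 0 w p).
Proof.
move=> gm gi p q hp hq; rewrite /lexle !(nth_map 0) ?(size_perm_iota w_perm) //.
have := nth_perm_iota w_perm hp; have := nth_perm_iota w_perm hq.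
have := index_nth_perm w_perm hp; have := index_nth_perm w_perm hq.
set x := nth 0 w p; set y := nth 0 w q => iy ix hy hx.
case: (ltngtP x y) => hxy.
- have := gm x y; have := gi x y; lia.
- have := gm y x; have := gi y x; lia.
- by move: iy ix; rewrite hxy; lia.
Qed.

Lemma std_map_bi : std_word (map (bi w) w) = w.
Proof.
apply: (std_wordP w_perm); rewrite ?size_map ?(size_perm_iota w_perm) //.
apply: lexle_map => [x y x0 xy|]; last exact: bi_eq_index.
by apply: bi_homo => //; lia.
Qed.

Lemma sorted_filter_perm (P : pred nat) :
  (forall x y, P x -> P y -> 0 < x -> x < y <= N -> index x w < index y w) ->
  sorted ltn (filter P w).
Proof.
move=> H; have u := uniq_perm_iota w_perm.
have: sorted (relpre (index^~ w) ltn) w.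
  rewrite -sorted_map (_ : map _ w = iota 0 (size w)) ?iota_ltn_sorted //.
  apply: (@eq_from_nth _ 0); rewrite size_map ?size_iota // => p hp.
  by rewrite (nth_map 0) // nth_iota // index_uniq.
move/(sorted_filter (leT := relpre (index^~ w) ltn)) => /(_ _ P) hs.
have {}hs : sorted (relpre (index^~ w) ltn) (filter P w).
  by apply: hs => a b c /=; apply: ltn_trans.
apply: (sub_in_sorted (P := mem (filter P w)) _ _ hs); last by apply/allP.
move=> x y; rewrite /= !mem_filter => /andP[Px xw] /andP[Py yw] /= hi.
rewrite !(mem_perm_iota w_perm) in xw yw.
have := H y x Py Px; case: (ltngtP x y) => // [h|h]; first by lia.
by move: hi; rewrite h ltnn.
Qed.

Lemma filter_perm_iota (P : pred nat) a n :
  0 < a -> a + n <= N.+1 ->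
  (forall x, 0 < x <= N -> P x = (a <= x < a + n)) ->
  (forall x y, a <= x -> x < y < a + n -> index x w < index y w) ->
  filter P w = iota a n.
Proof.
move=> a0 anN PE H; apply: (irr_sorted_eq ltn_trans ltnn).
- apply: sorted_filter_perm => x y Px Py x0 xy; move: Px Py; rewrite !PE; try lia.
  by move=> hx hy; apply: H; lia.
- exact: iota_ltn_sorted.
- move=> x; rewrite mem_filter mem_iota (mem_perm_iota w_perm).
  by case xN: (0 < x <= N); [rewrite PE // andbT | rewrite andbF; lia].
Qed.

End BlocksOfPerm.

(** * Reading words of tableaux *)

Lemma rowword_map (g : nat -> nat) t : rowword (map (map g) t) = map g (rowword t).
Proof. by rewrite /rowword -map_rev map_flatten. Qed.

Lemma shape_map (g : nat -> nat) t : Defs.shape (map (map g) t) = Defs.shape t.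
Proof. by rewrite /Defs.shape -map_comp; apply: eq_map => r /=; rewrite size_map. Qed.

Lemma size_rowword t : size (rowword t) = sumn (Defs.shape t).
Proof. by rewrite /rowword size_flatten /shape map_rev sumn_rev. Qed.

Lemma rowwordK t : tab_of_word (Defs.shape t) (rowword t) = t.
Proof.
by rewrite /tab_of_word /rowword /Defs.shape -map_rev flattenK revK.
Qed.

Lemma tab_of_wordK sh w : size w = sumn sh -> rowword (tab_of_word sh w) = w.
Proof. by move=> sw; rewrite /rowword revK reshapeKr // sumn_rev sw. Qed.

Lemma shape_tab_of_word sh w : size w = sumn sh -> Defs.shape (tab_of_word sh w) = sh.
Proof.
move=> sw; rewrite /Defs.shape /tab_of_word map_rev.
by rewrite -[map size _]/(seq.shape _) reshapeKl ?revK // sumn_rev sw.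
Qed.

Lemma perm_rowword t : perm_eq (flatten t) (rowword t).
Proof.
elim: t => //= r t IHt; rewrite /rowword rev_cons flatten_rcons.
by rewrite perm_sym perm_catC perm_cat2l perm_sym.
Qed.

(* Position in the reading word of the cell in row [r] and column [c]. *)
Definition pos (sh : seq nat) (r c : nat) : nat := sumn (drop r.+1 sh) + c.

Lemma rowword_cat t1 t2 : rowword (t1 ++ t2) = rowword t2 ++ rowword t1.
Proof. by rewrite /rowword rev_cat flatten_cat. Qed.

Lemma rowword_cons r t : rowword (r :: t) = rowword t ++ r.
Proof. by rewrite /rowword rev_cons flatten_rcons. Qed.

Lemma nth_shape t r : nth 0 (Defs.shape t) r = size (nth [::] t r).
Proof.
have [h|h] := ltnP r (size t); first by rewrite (nth_map [::]).
by rewrite !nth_default ?size_map.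
Qed.

Lemma nth_rowword t r c : c < nth 0 (Defs.shape t) r ->
  nth 0 (rowword t) (pos (Defs.shape t) r c) = nth 0 (nth [::] t r) c.
Proof.
rewrite nth_shape => hc; have hr : r < size t.
  by rewrite ltnNge; apply/negP => h; rewrite nth_default in hc.
rewrite -{1}(cat_take_drop r t) (drop_nth [::] hr) rowword_cat rowword_cons.
rewrite -catA nth_cat /pos size_rowword /Defs.shape map_drop.
by rewrite ltnNge leq_addr /= addKn nth_cat hc.
Qed.

Lemma posP sh p : p < sumn sh ->
  exists r c, [/\ r < size sh, c < nth 0 sh r & p = pos sh r c].
Proof.
elim: sh => //= a sh IHsh hp.
have [h|h] := ltnP p (sumn sh).
  by have [r [c [hr hc ->]]] := IHsh h; exists r.+1, c.
exists 0, (p - sumn sh); rewrite /pos /= drop0; split=> //; lia.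
Qed.

Lemma sumn_drop_ge sh r r' : r < r' ->
  nth 0 sh r' + sumn (drop r'.+1 sh) <= sumn (drop r.+1 sh).
Proof.
elim: sh r r' => [|a sh IHsh] r r' h; first by rewrite nth_nil.
case: r' h => // r' h; case: r h => [_|r h] /=; last exact: IHsh.
rewrite drop0; have [hs|hs] := ltnP r' (size sh).
  by rewrite -{3}(cat_take_drop r' sh) sumn_cat (drop_nth 0 hs) /=; lia.
by rewrite nth_default // drop_oversize //; lia.
Qed.

Lemma pos_lt sh r r' c c' : r < r' -> c' < nth 0 sh r' -> pos sh r' c' < pos sh r c.
Proof. by move=> /(sumn_drop_ge sh); rewrite /pos; lia. Qed.

Lemma pos_bound sh r c : c < nth 0 sh r -> pos sh r c < sumn sh.
Proof.
case: sh => [|a sh]; first by rewrite nth_nil.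
case: r => [|r] hc; first by rewrite /pos /= drop0 /= in hc *; lia.
by have := pos_lt 0 (ltn0Sn r) hc; rewrite {2}/pos /= drop0; lia.
Qed.

Lemma partition_nth lam r : is_partition lam -> nth 0 lam r.+1 <= nth 0 lam r.
Proof.
case/andP=> hs _; have [h|h] := ltnP r.+1 (size lam); last by rewrite nth_default.
have geq_trans : transitive geq by move=> a b c /= h1 h2; lia.
by apply: (sorted_leq_nth geq_trans (fun a => leqnn a) 0 hs); rewrite ?inE; lia.
Qed.

Lemma partition_nth_gt0 lam r : is_partition lam -> r < size lam -> 0 < nth 0 lam r.
Proof. by case/andP=> _ /allP h hr; apply/h/mem_nth. Qed.

(** Semistandardness as a condition on positions of the reading word, so that relabelling,
    standardizing or changing one letter can be treated on words of a fixed shape. *)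
Definition ssyt_word (sh w : seq nat) : Prop :=
  (forall r c, c.+1 < nth 0 sh r ->
     nth 0 w (pos sh r c) <= nth 0 w (pos sh r c.+1)) /\
  (forall r c, c < nth 0 sh r.+1 ->
     nth 0 w (pos sh r c) < nth 0 w (pos sh r.+1 c)).

Lemma is_ssytP t : is_partition (Defs.shape t) ->
  is_ssyt t <-> ssyt_word (Defs.shape t) (rowword t).
Proof.
move=> hp; have hle r c : c < nth 0 (Defs.shape t) r.+1 -> c < nth 0 (Defs.shape t) r.
  by move=> h; apply: leq_trans h (partition_nth _ hp).
split=> [/andP[/allP hrow /allP hcol]|[hrow hcol]].
  split=> r c hc.
    rewrite !nth_rowword //; last by lia.
    have hr : r < size t.
      by rewrite -(size_map size t) ltnNge; apply/negP => h; rewrite nth_default in hc.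
    have /(sorted_ltn_nth leq_trans 0) := hrow _ (mem_nth [::] hr).
    by apply; rewrite ?inE -?nth_shape; lia.
  rewrite !nth_rowword //; last exact: hle.
  have hr : r < size t.
    rewrite -(size_map size t) ltnNge; apply/negP => h.
    by rewrite nth_default // in hc; apply: leq_trans h _.
  have /allP h : all (fun c => nth 0 (nth [::] t r) c < nth 0 (nth [::] t r.+1) c)
                     (iota 0 (size (nth [::] t r.+1))).
    by apply: hcol; rewrite mem_iota.
  by apply: h; rewrite mem_iota -nth_shape.
apply/andP; split; apply/allP.
  move=> R /(nthP [::])[r hr <-]; apply/(sortedP 0) => c; rewrite -nth_shape => hc.
  by rewrite -!nth_rowword ?(ltnW hc) // hrow.
move=> r _; apply/allP => c; rewrite mem_iota -nth_shape => hc.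
by rewrite -!nth_rowword; [apply: hcol|exact: hc|apply: hle].
Qed.

Lemma ssyt_word_row sh w r c c' : ssyt_word sh w -> c <= c' -> c' < nth 0 sh r ->
  nth 0 w (pos sh r c) <= nth 0 w (pos sh r c').
Proof.
move=> [hw _] /subnK <-; elim: (c' - c) => // k IHk h.
by apply: leq_trans (IHk _) (hw _ _ _); rewrite ?addSn in h *; lia.
Qed.

(** * Descent composition *)

Section Composition.

Variable N : nat.

(** The differences in [Des] with a free starting point [s], which makes induction on the list of
    descents possible. *)
Definition parts (s : nat) (D : seq nat) : seq nat :=
  [seq p.2 - p.1 | p <- zip (s :: D) (rcons D N)].

Lemma size_parts s D : size (parts s D) = (size D).+1.
Proof. by rewrite size_map size_zip /= size_rcons minnn. Qed.

Lemma mem_parts s D x k : path ltn s (rcons D N) -> s < x <= N ->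
  (x - s \in iota (sumn (take k (parts s D))).+1 (nth 0 (parts s D) k))
    = (count (fun d => d < x) D == k).
Proof.
elim: D s k => [|d D IHD] s k /= hD hx.
  case: k => [|k] /=; rewrite mem_iota /=; first by lia.
  by rewrite nth_nil; lia.
case/andP: hD => sd hD.
have hd e : e \in D -> d < e.
  move=> eD; have /allP := order_path_min ltn_trans hD; apply.
  by rewrite mem_rcons inE eD orbT.
have c0 : x <= d -> count (fun d => d < x) D = 0.
  move=> xd; apply/eqP; rewrite eqn0Ngt -has_count; apply/hasP => -[e /hd]; lia.
case: k => [|k] /=; rewrite mem_iota /=.
  move: c0; set c := count _ D; case: (leqP x d) => h c0; first by rewrite c0; lia.
  by lia.
case: (leqP x d) => h; first by rewrite c0 // add0n; lia.
rewrite -/(parts d D) -[RHS]/(count _ D == k) -(IHD d) // ?mem_iota; last by lia.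
by set a := sumn _; set b := nth 0 _ _; lia.
Qed.

End Composition.

Lemma find_iota1 n c : c < n -> find (pred1 c.+1) (iota 1 n) = c.
Proof.
move=> hc; rewrite -[find _ _]/(index c.+1 (iota 1 n)).
by rewrite -[c.+1](nth_iota 0 1 hc) index_uniq ?size_iota ?iota_uniq.
Qed.

Section Descents.

Variables (lam : seq nat) (T : tableau).
Hypotheses (lam_part : is_partition lam) (T_syt : is_SYT lam T).
Let N := sumn lam.
Let w := rowword T.

Lemma syt_shape : Defs.shape T = lam.
Proof. by case/and3P: T_syt => /eqP. Qed.

Lemma syt_word : ssyt_word lam w.
Proof. by case/and3P: T_syt => /eqP <- h _; apply/is_ssytP; rewrite ?syt_shape. Qed.

Lemma syt_perm : perm_eq w (iota 1 N).
Proof.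
case/and3P: T_syt => _ _; apply: perm_trans.
by rewrite perm_sym perm_rowword.
Qed.

(** [row_of] finds the first row containing [x]; since entries are distinct, it is the row of the
    cell read at [index x w]. *)
Lemma row_of_pos x : 0 < x <= N ->
  exists2 c, c < nth 0 lam (row_of T x) & index x w = pos lam (row_of T x) c.
Proof.
move=> hx; have hi := index_perm_lt syt_perm hx.
have [r [c [hr hc hp]]] := posP hi.
have rowP r' c' : c' < nth 0 lam r' -> nth 0 w (pos lam r' c') = nth 0 (nth [::] T r') c'.
  by move=> h; rewrite /w -syt_shape nth_rowword // syt_shape.
have ex : nth 0 (nth [::] T r) c = x by rewrite -rowP // -hp (nth_index_perm syt_perm).
have sT : size T = size lam by rewrite -syt_shape size_map.
have xr : x \in nth [::] T r by rewrite -ex mem_nth // -nth_shape syt_shape.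
have hle : row_of T x <= r.
  by rewrite leqNgt; apply/negP => h; have := before_find [::] h; rewrite xr.
have hrow : x \in nth [::] T (row_of T x).
  have := @nth_find _ [::] (fun R => x \in R) T; apply.
  by apply/hasP; exists (nth [::] T r); rewrite // mem_nth // sT.
suff -> : row_of T x = r by exists c.
apply/eqP; rewrite eqn_leq hle leqNgt; apply/negP => hlt.
have /(nthP 0)[c' hc' e'] := hrow.
rewrite -nth_shape syt_shape in hc'.
have := pos_lt c' hlt hc; rewrite -hp -(rowP _ _ hc') in e' *.
by rewrite -{1}e' (index_nth_perm syt_perm) ?ltnn // pos_bound.
Qed.

(** Different rows are read from the top; within one row, increasing entries force [d] to be read
    before [d.+1]. *)
Lemma row_of_desw d : 0 < d < N -> (row_of T d < row_of T d.+1) = desw w d.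
Proof.
move=> hd; have hd0 : 0 < d <= N by lia. have hd1 : 0 < d.+1 <= N by lia.
have [c hc ic] := row_of_pos hd0; have [c' hc' ic'] := row_of_pos hd1.
rewrite /desw ic ic'; case: (ltngtP (row_of T d) (row_of T d.+1)) => h.
- by rewrite (pos_lt c h hc').
- by have := pos_lt c' h hc; lia.
- rewrite /pos h ltn_add2l; apply/esym/negbTE; rewrite -leqNgt leqNgt.
  apply/negP => hcc; rewrite h in hc ic.
  have := ssyt_word_row syt_word (ltnW hcc) hc.
  by rewrite -ic -ic' !(nth_index_perm syt_perm) //; lia.
Qed.

Lemma descentsE : descents T = filter (desw w) (iota 1 N.-1).
Proof.
rewrite /descents syt_shape; apply: eq_in_filter => d; rewrite mem_iota => hd.
by apply: row_of_desw; rewrite -/N in hd; lia.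
Qed.

Lemma count_descents x : 0 < x <= N ->
  (count (fun d => d < x) (descents T)).+1 = bi w x.
Proof.
move=> hx; rewrite descentsE /bi count_filter; congr _.+1.
have -> : N.-1 = x.-1 + (N - x) by lia.
rewrite iotaD count_cat [X in _ + X](_ : _ = 0) ?addn0; last first.
  by apply/eqP; rewrite eqn0Ngt -has_count; apply/hasP => -[d]; rewrite mem_iota /=; lia.
apply: eq_in_count => d; rewrite mem_iota /= => hd.
by have -> : d < x by lia.
Qed.

Hypothesis N_gt0 : 0 < N.

Lemma DesE : Des T = parts N 0 (descents T).
Proof. by rewrite /Des syt_shape -/N eqn0Ngt N_gt0. Qed.

Lemma size_Des : size (Des T) = bi w N.
Proof.
rewrite DesE size_parts -count_descents; last by lia.
congr _.+1; rewrite -[LHS]addn0 descentsE; apply/esym/eqP.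
rewrite addn0 -all_count; apply/allP => d; rewrite mem_filter mem_iota; lia.
Qed.

Lemma mem_block x j : 0 < x <= N -> (x \in block (Des T) j.+1) = (bi w x == j.+1).
Proof.
move=> hx; rewrite -count_descents // eqSS /block DesE /=.
rewrite -[in LHS](subn0 x) mem_parts //.
have : sorted ltn (descents T).
  by rewrite descentsE sorted_filter ?iota_ltn_sorted //; apply: ltn_trans.
have : {in descents T, forall d, 0 < d < N}.
  by move=> d; rewrite descentsE mem_filter mem_iota; lia.
case: (descents T) => [|d D] hd /= hs; first by rewrite N_gt0.
rewrite rcons_path hs /=; have := hd d (mem_head _ _).
by have := hd (last d D) (mem_last _ _); lia.
Qed.

Lemma block_indexE x : 0 < x <= N -> block_index (Des T) x = bi w x.
Proof.
move=> hx; rewrite /block_index.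
have -> : find (fun j => x \in block (Des T) j) (iota 1 (size (Des T)))
        = find (pred1 (bi w x)) (iota 1 (size (Des T))).
  rewrite -[1]addn0 iotaDl !find_map; apply: eq_find => j /=.
  by rewrite add1n mem_block // eq_sym.
rewrite -[bi w x]prednK // find_iota1 // size_Des.
by rewrite prednK // bi_homo //; lia.
Qed.

Lemma rowword_phi : rowword (phi T) = map (bi w) w.
Proof.
rewrite /phi rowword_map; apply/eq_in_map => x.
by rewrite (mem_perm_iota syt_perm) => /block_indexE.
Qed.

Lemma shape_phi : Defs.shape (phi T) = lam.
Proof. by rewrite shape_map syt_shape. Qed.

End Descents.

(** * Standardization inverts the collapse map on vertices *)

Lemma sumn_partition_gt0 lam : is_partition lam -> 0 < size lam -> 0 < sumn lam.
Proof.
move=> hp hs; have := partition_nth_gt0 hp hs.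
by case: lam {hp} hs => //= a s _; lia.
Qed.

(** In a column, two entries of the same block would be read in increasing order, but the upper,
    larger one is read first. *)
Lemma ssyt_word_map_bi lam w : is_partition lam -> perm_eq w (iota 1 (sumn lam)) ->
  ssyt_word lam w -> ssyt_word lam (map (bi w) w).
Proof.
move=> lam_part wp [hrow hcol]; have sw := size_perm_iota wp.
split=> r c hc.
  have h1 := pos_bound hc; have h2 : pos lam r c < sumn lam by apply: pos_bound; lia.
  rewrite !(nth_map 0) ?sw //; apply: bi_homo; last exact: hrow.
  by case/andP: (nth_perm_iota wp h2).
have h1 := pos_bound hc; have hc' := leq_trans hc (partition_nth r lam_part).
have h2 := pos_bound hc'.
rewrite !(nth_map 0) ?sw //; have hlt := hcol _ _ hc.
have hx := nth_perm_iota wp h1; have hy := nth_perm_iota wp h2.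
rewrite ltn_neqAle bi_homo ?andbT; [|lia..].
apply/eqP => /(bi_eq_index_le _); rewrite !(index_nth_perm wp) // => h.
have := pos_lt c (ltnSn r) hc; rewrite ltnNge h //; lia.
Qed.

Section FirstColumn.

Variables (lam v : seq nat).
Hypotheses (lam_part : is_partition lam) (v_ssyt : ssyt_word lam v).
Hypothesis v_range : forall p, p < sumn lam -> 0 < nth 0 v p <= size lam.

(** Strict columns bound the entry below by [r.+1], counting from the bottom, and above by [r.+1],
    counting down from the top row, whose entry is at most the number of rows. *)
Lemma first_column r : r < size lam -> nth 0 v (pos lam r 0) = r.+1.
Proof.
have pos0 s : s < size lam -> pos lam s 0 < sumn lam.
  by move=> hs; apply: pos_bound; apply: partition_nth_gt0.
have stp s : s.+1 < size lam -> nth 0 v (pos lam s 0) < nth 0 v (pos lam s.+1 0).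
  by move=> hs; apply: (proj2 v_ssyt); apply: partition_nth_gt0.
have lo s : s < size lam -> s < nth 0 v (pos lam s 0).
  elim: s => [|s IHs] hs; first by have := v_range (pos0 _ hs); lia.
  by apply: leq_ltn_trans (stp _ hs); apply: IHs; lia.
have hi k s : s + k.+1 = size lam -> nth 0 v (pos lam s 0) <= s.+1.
  elim: k s => [|k IHk] s hs.
    by have := v_range (pos0 s _); lia.
  have := IHk s.+1; have := stp s; lia.
by move=> hr; have := lo r hr; have := hi (size lam - r.+1) r; lia.
Qed.

(** Row [j], numbered from 0, starts with the letter [j.+1]. Hence a letter [j] lies in a strictly
    lower row, which is read later. *)
Lemma first_column_before j q : j < size lam -> q < sumn lam ->
  nth 0 v q = j -> pos lam j 0 < q.
Proof.
move=> hj /posP[r [c [hr hc ->]]] e.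
have [h|h] := ltnP r j; first by apply: pos_lt => //; apply: partition_nth_gt0.
have := ssyt_word_row v_ssyt (leq0n c) hc; rewrite first_column //; lia.
Qed.

End FirstColumn.

Section Standardization.

Variables (lam v : seq nat).
Hypotheses (lam_part : is_partition lam) (lam_gt0 : 0 < size lam).
Hypotheses (v_ssyt : ssyt_word lam v) (size_v : size v = sumn lam).
Hypothesis v_range : forall p, p < sumn lam -> 0 < nth 0 v p <= size lam.
Let N := sumn lam.
Let w := std_word v.

Lemma std_perm : perm_eq w (iota 1 N).
Proof. by rewrite -[N]size_v; apply: std_word_perm. Qed.

Lemma ssyt_word_std : ssyt_word lam w.
Proof.
split=> r c hc.
  have h1 := pos_bound hc; have h2 : pos lam r c < sumn lam by apply: pos_bound; lia.
  rewrite std_word_le ?size_v // /lexle; have := proj1 v_ssyt r c hc.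
  by rewrite /pos; lia.
have h1 := pos_bound hc; have h2 := pos_bound (leq_trans hc (partition_nth r lam_part)).
rewrite ltnNge std_word_le ?size_v // /lexle; have := proj2 v_ssyt r c hc; lia.
Qed.

(** Induction on [x]: equal letters are numbered from left to right and give no descent, while
    passing to the next letter must give one. *)
Lemma bi_std x : 0 < x <= N -> bi w x = nth 0 v (index x w).
Proof.
have wp := std_perm.
have pos0 s : s < size lam -> pos lam s 0 < N.
  by move=> hs; apply: pos_bound; apply: partition_nth_gt0.
have fc := first_column lam_part v_ssyt v_range.
have le_std p q : p < N -> q < N -> (nth 0 w q <= nth 0 w p) = lexle v q p.
  by move=> hp hq; rewrite std_word_le ?size_v.
elim: x => // x IHx hx1; case: (posnP x) => [->|x0].
  have h1 : 0 < 1 <= N by lia.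
  have hi := index_perm_lt wp h1; have := le_std _ _ (pos0 0 lam_gt0) hi.
  rewrite (nth_index_perm wp) //; have := nth_perm_iota wp (pos0 0 lam_gt0).
  rewrite /lexle fc //; have := v_range hi; rewrite /bi /=; lia.
have hx : 0 < x <= N by lia.
rewrite biS // IHx // /desw.
have hq := index_perm_lt wp hx; have hq' := index_perm_lt wp hx1.
have eq := nth_index_perm wp hx; have eq' := nth_index_perm wp hx1.
have := le_std _ _ hq hq'; have := le_std _ _ hq' hq.
rewrite eq eq' /lexle; set q := index x w in hq eq *; set q' := index _ w in hq' eq' *.
have := v_range hq; have := v_range hq'.
case: (ltngtP (nth 0 v q) (nth 0 v q')) => h rq' rq; try lia.
(* With [j] the letter at [q], the first-column [j.+1] is numbered at least [x.+1]. So [x.+1] sits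
   on a letter [j.+1] read no later than that one, hence before [q]. *)
move=> _ _; have hf : nth 0 v q < size lam by lia.
have := first_column_before lam_part v_ssyt v_range hf hq erefl.
have := le_std _ _ hq (pos0 _ hf); have := le_std _ _ hq' (pos0 _ hf).
have := le_std _ _ (pos0 _ hf) hq'.
rewrite /lexle fc // eq eq'; lia.
Qed.

(** The largest letter occurs, at the top of the first column, so [N] is placed on such a letter. *)
Lemma bi_std_last : bi w N = size lam.
Proof.
have N0 := sumn_partition_gt0 lam_part lam_gt0; rewrite -/N in N0.
have hN : 0 < N <= N by lia.
have hl : (size lam).-1 < size lam by lia.
have hp : pos lam (size lam).-1 0 < N by apply: pos_bound; apply: partition_nth_gt0.
rewrite bi_std //; have hi := index_perm_lt std_perm hN.
have := std_word_le (v := v) (p := index N w) (q := pos lam (size lam).-1 0).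
rewrite size_v -/w (nth_index_perm std_perm) // => /(_ hi hp).
have := nth_perm_iota std_perm hp; rewrite /lexle (first_column lam_part v_ssyt v_range) //.
have := v_range hi; lia.
Qed.

Lemma map_bi_std : map (bi w) w = v.
Proof.
apply: (@eq_from_nth _ 0); rewrite size_map size_std_word // => p hp.
rewrite (nth_map 0) ?size_std_word //; rewrite size_v in hp.
by rewrite bi_std ?(nth_perm_iota std_perm) // (index_nth_perm std_perm).
Qed.

End Standardization.

Section Vertices.

Variable lam : seq nat.
Hypotheses (lam_part : is_partition lam) (lam_gt0 : 0 < size lam).
Let N := sumn lam.
Let N_gt0 : 0 < N := sumn_partition_gt0 lam_part lam_gt0.

Lemma CSvertP T : reflect (is_SYT lam T /\ bi (rowword T) N = size lam) (T \in CSvert lam).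
Proof.
rewrite inE /=; apply: (iffP andP) => -[hT].
  by rewrite (size_Des lam_part hT N_gt0) => /eqP.
by move=> h; rewrite (size_Des lam_part hT N_gt0) h.
Qed.

Lemma BvertP b : b \in Bvert lam <->
  [/\ Defs.shape b = lam, ssyt_word lam (rowword b)
    & forall p, p < N -> 0 < nth 0 (rowword b) p <= size lam].
Proof.
rewrite inE /= /is_SSYT (perm_all _ (perm_rowword b)); split.
  case/and3P=> /eqP sb hb /(all_nthP 0) hr; split=> //.
    by rewrite -[in ssyt_word lam]sb; apply/is_ssytP; rewrite ?sb.
  by move=> p hp; apply: hr; rewrite size_rowword sb.
case=> sb hb hr; apply/and3P; split; first by apply/eqP.
  by apply/is_ssytP; rewrite sb.
by apply/(all_nthP 0) => p; rewrite size_rowword sb => /hr.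
Qed.

Lemma tab_Bvert v : size v = N -> ssyt_word lam v ->
  (forall p, p < N -> 0 < nth 0 v p <= size lam) -> tab_of_word lam v \in Bvert lam.
Proof.
move=> sv hv hr; apply/BvertP.
by rewrite tab_of_wordK // shape_tab_of_word.
Qed.

Lemma phi_Bvert T : T \in CSvert lam -> phi T \in Bvert lam.
Proof.
case/CSvertP=> hT hl; have wp := syt_perm hT; apply/BvertP.
rewrite (shape_phi hT) (rowword_phi lam_part hT N_gt0); split=> //.
  by apply: ssyt_word_map_bi => //; apply: syt_word.
move=> p hp; rewrite (nth_map 0) ?(size_perm_iota wp) // bi_gt0 -hl.
by have := nth_perm_iota wp hp; case/andP => h1 h2; apply: bi_homo.
Qed.

Lemma std_phi T : T \in CSvert lam -> std_tab (phi T) = T.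
Proof.
case/CSvertP=> hT hl; have wp := syt_perm hT.
by rewrite /std_tab (shape_phi hT) (rowword_phi lam_part hT N_gt0) (std_map_bi wp) -(syt_shape hT) rowwordK.
Qed.

Lemma std_tab_vert b : b \in Bvert lam -> std_tab b \in CSvert lam /\ phi (std_tab b) = b.
Proof.
case/BvertP=> sb hb hr.
have sv : size (rowword b) = sumn lam by rewrite size_rowword sb.
have ss : size (std_word (rowword b)) = sumn lam by rewrite size_std_word.
have rs : rowword (std_tab b) = std_word (rowword b) by rewrite /std_tab sb tab_of_wordK.
have hs : Defs.shape (std_tab b) = lam by rewrite /std_tab sb shape_tab_of_word.
have hT : is_SYT lam (std_tab b).
  apply/and3P; split; first by apply/eqP.
    by apply/is_ssytP; rewrite hs // rs; apply: ssyt_word_std.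
  by rewrite (perm_trans (perm_rowword _)) // rs std_perm.
split; first by apply/CSvertP; rewrite rs; split=> //; apply: bi_std_last.
by rewrite -[LHS]rowwordK (shape_phi hT) (rowword_phi lam_part hT N_gt0) rs (map_bi_std lam_part lam_gt0 hb sv hr) -sb rowwordK.
Qed.

End Vertices.

(** * The bracketing rule *)

(* Number of unbracketed letters [j.+1] after reading [w], starting from [o]. *)
Fixpoint opn (j : nat) (w : seq nat) (o : nat) : nat :=
  match w with
  | [::] => o
  | x :: w' => if x == j.+1 then opn j w' o.+1
               else if x == j then opn j w' o.-1 else opn j w' o
  end.

(* Every letter [j] of [w] is bracketed when [o] letters [j.+1] are available before [w]. *)
Fixpoint closed_j (j : nat) (w : seq nat) (o : nat) : bool :=
  match w with
  | [::] => true
  | x :: w' => if x == j.+1 then closed_j j w' o.+1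
               else if x == j then (0 < o) && closed_j j w' o.-1 else closed_j j w' o
  end.

Lemma opn_cat j w1 w2 o : opn j (w1 ++ w2) o = opn j w2 (opn j w1 o).
Proof. by elim: w1 o => //= x w1 IH o; do 2 case: ifP => // _. Qed.

Lemma opn_filter j (P : pred nat) w o :
  P j -> P j.+1 -> opn j (filter P w) o = opn j w o.
Proof.
move=> Pj Pj1; elim: w o => //= x w IHw o.
case Px: (P x) => /=; first by do 2 case: ifP => // _.
case: eqP => [e|_]; first by rewrite e Pj1 in Px.
by case: eqP => [e|_]; first by rewrite e Pj in Px.
Qed.

Definition cnt (x : nat) (w : seq nat) : nat := count_mem x w.

Arguments cnt : simpl never.

Lemma cnt_cons x y w : cnt x (y :: w) = (y == x) + cnt x w.
Proof. by []. Qed.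

Lemma closed_opn j w o : closed_j j w o -> opn j w o + cnt j w = o + cnt j.+1 w.
Proof.
elim: w o => // x w IHw o; rewrite !cnt_cons /=.
have [->|xj1] := eqVneq x j.+1; first by move=> /IHw; rewrite (_ : j.+1 == j = false); lia.
have [_|xj] := eqVneq x j; last by move=> /IHw; lia.
by case/andP=> o0 /IHw; lia.
Qed.

(** [opn] is a walk truncated at zero: its end is the maximum of the untruncated end and of the
    excesses of [j.+1] over [j] in the suffixes. *)
Lemma opn_leP j w o k : opn j w o <= k <->
  (forall s, cnt j.+1 (drop s w) <= cnt j (drop s w) + k) /\
  o + cnt j.+1 w <= cnt j w + k.
Proof.
elim: w o => [|x w IHw] o /=; first by rewrite /cnt /=; split=> [h|[_]]; [split=> //=|]; lia.
have dS (Q : nat -> Prop) : (forall s, Q s) <-> Q 0 /\ forall s, Q s.+1.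
  by split=> [h|[h0 h]]; [split|case].
rewrite dS /= !cnt_cons {dS}; have := IHw; have [->|xj1] := eqVneq x j.+1 => {}IHw.
  rewrite IHw (_ : j.+1 == j = false); last by lia.
  by split=> [[h1 h2]|[[h0 h1] h2]]; (do ?split) => //; lia.
have [_|xj] := eqVneq x j; rewrite IHw.
  split=> [[h1 h2]|[[h0 h1] h2]]; (do ?split) => //; try lia.
  by have := h1 0; rewrite drop0; lia.
split=> [[h1 h2]|[[h0 h1] h2]]; (do ?split) => //; try lia.
Qed.

Lemma closed_jP j w o : closed_j j w o <->
  forall s, cnt j (take s w) <= cnt j.+1 (take s w) + o.
Proof.
elim: w o => [|x w IHw] o /=; first by split.
have dS (Q : nat -> Prop) : Q 0 -> (forall s, Q s) <-> forall s, Q s.+1.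
  by move=> Q0; split=> [h s|h [|s]].
rewrite dS //= {dS}; have [->|xj1] := eqVneq x j.+1.
  rewrite IHw; split=> h s; have := h s; rewrite !cnt_cons eqxx (_ : j.+1 == j = false); lia.
have [->|xj] := eqVneq x j; last first.
  by rewrite IHw; split=> h s; have := h s; rewrite !cnt_cons (negbTE xj1) (negbTE xj); lia.
have jj : j == j.+1 = false by lia.
split=> [/andP[o0 /IHw h] s|h]; first by have := h s; rewrite !cnt_cons eqxx jj; lia.
have := h 0; rewrite take0 /cnt /= eqxx jj => o0; apply/andP; split; first by lia.
by apply/IHw => s; have := h s; rewrite !cnt_cons eqxx jj; lia.
Qed.

(** Bracketing is stated by counts on segments adjacent to [p], because counts can be compared
    between [phi T] and the collapsed word. *)
Definition rightmost_unbracketed (j : nat) (w : seq nat) (p : nat) : Prop :=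
  [/\ p < size w, nth 0 w p = j,
      forall s, cnt j.+1 (drop s (take p w)) <= cnt j (drop s (take p w))
    & forall s, cnt j (take s (drop p.+1 w))
                  <= cnt j.+1 (take s (drop p.+1 w))].

Lemma rightmost_unbracketedP j w p : rightmost_unbracketed j w p <->
  [/\ p < size w, nth 0 w p = j, opn j (take p w) 0 = 0 & closed_j j (drop p.+1 w) 0].
Proof.
split=> -[h1 h2 h3 h4]; split=> //.
- by apply/eqP; rewrite -leqn0; apply/opn_leP; split=> [s|]; [have := h3 s|have := h3 0; rewrite drop0]; lia.
- by apply/closed_jP => s; have := h4 s; lia.
- by move/eqP: h3; rewrite -leqn0 => /opn_leP[h _] s; have := h s; lia.
- by move/closed_jP: h4 => h s; have := h s; lia.
Qed.

Lemma fpos_closed j w i o best : closed_j j w o -> fpos j w i o best = best.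
Proof.
elim: w i o => //= x w IHw i o.
case: ifP => _; first exact: IHw.
by case: ifP => _; [case: o => //= o; apply: IHw | apply: IHw].
Qed.

(** The candidate [best'] can stay unspecified: an unbracketed letter just after the cut overwrites
    it. *)
Lemma fpos_cat j w1 w2 i o best : exists best',
  fpos j (w1 ++ w2) i o best = fpos j w2 (i + size w1) (opn j w1 o) best'.
Proof.
elim: w1 i o best => [|x w1 IHw] i o best /=; first by exists best; rewrite addn0.
rewrite addnS -addSn; case: ifP => _; first exact: IHw.
by case: ifP => _; [case: o => [|o]; apply: IHw | apply: IHw].
Qed.

Lemma fpos_Some j w i o best p : fpos j w i o best = Some p ->
  best = Some p /\ closed_j j w o \/
  exists w1 w2, [/\ w = w1 ++ j :: w2, p = i + size w1, opn j w1 o = 0 & closed_j j w2 0].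
Proof.
elim: w i o best => [|x w IHw] i o best /=; first by left.
case e1: (x == j.+1).
  move=> /IHw[[-> h]|[w1 [w2 [-> -> h1 h2]]]]; [by left|right].
  by exists (x :: w1), w2; rewrite /= e1; split; rewrite // addSnnS.
case e2: (x == j); last first.
  move=> /IHw[[-> h]|[w1 [w2 [-> -> h1 h2]]]]; [by left|right].
  by exists (x :: w1), w2; rewrite /= e1 e2; split; rewrite // addSnnS.
case: o => [|o] /IHw[[hb h]|[w1 [w2 [-> -> h1 h2]]]].
- by right; exists [::], w; case: hb => <-; rewrite (eqP e2) /= addn0.
- by right; exists (x :: w1), w2; rewrite /= e1 e2; split; rewrite // addSnnS.
- by left.
- by right; exists (x :: w1), w2; rewrite /= e1 e2; split; rewrite // addSnnS.
Qed.

Lemma fposP j w p : fpos j w 0 0 None = Some p <-> rightmost_unbracketed j w p.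
Proof.
rewrite rightmost_unbracketedP; split.
  case/fpos_Some=> [[]//|[w1 [w2 [-> -> h1 h2]]]]; rewrite add0n.
  split=> //; first by rewrite size_cat /=; lia.
  - by rewrite nth_cat ltnn subnn.
  - by rewrite take_size_cat.
  - by rewrite -cat_rcons drop_size_cat // size_rcons.
case=> h1 h2 h3 h4; rewrite -{1}(cat_take_drop p w) (drop_nth 0 h1) h2.
have [best' ->] := fpos_cat j (take p w) (j :: drop p.+1 w) 0 0 None.
rewrite h3 /= (_ : j == j.+1 = false) ?eqxx; last by lia.
by rewrite fpos_closed // size_takel // ltnW.
Qed.

Lemma f_tabE j t p : rightmost_unbracketed j (rowword t) p ->
  f_tab j t = Some (tab_of_word (Defs.shape t) (set_nth 0 (rowword t) p j.+1)).
Proof. by move=> /fposP h; rewrite /f_tab /f_word h. Qed.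

Lemma f_tabP j t b : f_tab j t = Some b -> exists2 p, rightmost_unbracketed j (rowword t) p
  & b = tab_of_word (Defs.shape t) (set_nth 0 (rowword t) p j.+1).
Proof.
rewrite /f_tab /f_word; case e: (fpos _ _ _ _ _) => [p|] //= [<-].
by exists p => //; apply/fposP.
Qed.

(** * Crystal operators preserve semistandardness *)

Lemma count_drop_take (P : pred nat) (w : seq nat) a b : a <= b <= size w ->
  count P (drop a (take b w)) = count (fun q => P (nth 0 w q)) (iota a (b - a)).
Proof.
move=> hab; rewrite [LHS]count_nth_iota size_drop size_takel; last by lia.
rewrite -[in RHS](addn0 a) iotaDl count_map addn0; apply: eq_in_count => q.
by rewrite mem_iota => hq /=; rewrite nth_drop nth_take //; lia.
Qed.

Lemma ssyt_word_f lam v j p : is_partition lam -> size v = sumn lam ->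
  ssyt_word lam v -> rightmost_unbracketed j v p ->
  ssyt_word lam (set_nth 0 v p j.+1).
Proof.
move=> lam_part sv vs [hp vp hsuf hpre]; have [hrow hcol] := vs.
have hle r c : c < nth 0 lam r.+1 -> c < nth 0 lam r.
  by move=> h; apply: leq_trans h (partition_nth _ lam_part).
split=> r c hc; rewrite !nth_set_nth /=.
  have := hrow r c hc; case: eqP => [e|_]; last first.
    by case: eqP => [->|_] //; rewrite vp; lia.
  case: eqP => [|_]; first by lia.
  rewrite e vp leq_eqVlt => /orP[/eqP e'|//].
  (* An equal right neighbour would be a letter [j] directly after [p], contradicting the condition
     on the prefix of length 1. *)
  have hp1 : pos lam r c.+1 = p.+1 by rewrite -e /pos addnS.
  have := hpre 1; have hb := pos_bound hc; rewrite hp1 -sv in hb.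
  by rewrite (drop_nth 0 hb) /= take0 /cnt /= -hp1 -e'; lia.
have := hcol r c hc; case: (eqVneq (pos lam r c) p) => [e|_]; last first.
  by case: eqP => [->|_] //; rewrite vp; lia.
case: eqP => [|_]; first by have := pos_lt c (ltnSn r) hc; lia.
rewrite e vp leq_eqVlt => /orP[/eqP e'|//].
(* If the entry above were [j.+1], each [j] of row [r] up to column [c] would lie below a
   [j.+1] of row [r.+1], so the letter at [p] would be bracketed. *)
have hcr := hle _ _ hc.
(* [a] is the first column of row [r] with entry [j]; columns [a] to [c] then all carry [j]. *)
pose a := find (fun k => nth 0 v (pos lam r k) == j) (iota 0 c.+1).
have ha : a <= c.
  rewrite -ltnS -[c.+1](size_iota 0) -has_find; apply/hasP; exists c; rewrite ?mem_iota ?e ?vp //; lia.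
have va k : a <= k <= c -> nth 0 v (pos lam r k) = j.
  move=> hk; have : nth 0 v (pos lam r a) == j.
    have := @nth_find _ 0 (fun k => nth 0 v (pos lam r k) == j) (iota 0 c.+1).
    by rewrite -/a nth_iota // add0n; apply; rewrite has_find size_iota -/a.
  have hkc : k < nth 0 lam r by lia.
  have h1 := ssyt_word_row vs (c := a) (c' := k) _ hkc.
  by have := ssyt_word_row vs (c := k) _ hcr; rewrite e vp; lia.
have na k : k < a -> nth 0 v (pos lam r k) != j.
  move=> hk; have := @before_find _ 0 (fun k => nth 0 v (pos lam r k) == j) (iota 0 c.+1) k hk.
  by rewrite nth_iota // ?add0n => [->|]; lia.
have va1 k : a <= k <= c -> nth 0 v (pos lam r.+1 k) = j.+1.
  move=> hk; have hkc : k < nth 0 lam r.+1 by lia.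
  have := hcol _ _ hkc; rewrite va //.
  by have := ssyt_word_row vs (c := k) _ hc; lia.
pose L := nth 0 lam r.+1.
have posE : pos lam r 0 = pos lam r.+1 0 + L.
  rewrite /pos /L !addn0; have [hr|hr] := ltnP r.+1 (size lam).
    by rewrite (drop_nth 0 hr) /= addnC.
  by rewrite nth_default // in hc.
have pE k r' : pos lam r' k = pos lam r' 0 + k by rewrite /pos addn0.
(* The segment from the cell above column [a] up to [p] consists of [c.+1 - a] letters [j.+1], the
   rest of row [r.+1], the first [a] cells of row [r], and [c - a] further cells. Only the last
   piece contains letters [j], too few to close all the [j.+1]. *)
have eL : p - pos lam r.+1 a = (c.+1 - a) + ((L - c.+1) + (a + (c - a))).
  by rewrite -e (pE c) (pE a) posE; lia.
have := hsuf (pos lam r.+1 a); have hap : pos lam r.+1 a <= p <= size v.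
  by have := @pos_lt lam r r.+1 c a (ltnSn r); rewrite -/L e; lia.
rewrite /cnt !count_drop_take // eL !iotaD !count_cat; set A := pos lam r.+1 a.
have zero b n : {in iota b n, forall q, nth 0 v q != j} ->
    count (fun q => pred1 j (nth 0 v q)) (iota b n) = 0.
  move=> h; apply/eqP; rewrite eqn0Ngt -has_count; apply/hasP => -[q /h].
  by rewrite /= => /negbTE ->.
rewrite (zero A) => [|q]; last first.
  rewrite mem_iota /A pE => hq.
  have -> : q = pos lam r.+1 (q - pos lam r.+1 0) by rewrite [RHS]pE; lia.
  by rewrite va1; lia.
rewrite (zero (A + _)) => [|q]; last first.
  rewrite mem_iota /A pE => hq; have hqL : q - pos lam r.+1 0 < L by lia.
  have -> : q = pos lam r.+1 (q - pos lam r.+1 0) by rewrite [RHS]pE; lia.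
  have := ssyt_word_row vs (c := c) _ hqL; rewrite -e'; lia.
rewrite (zero (A + _ + _)) => [|q]; last first.
  rewrite mem_iota /A pE => hq.
  have -> : q = pos lam r (q - pos lam r 0) by rewrite [RHS]pE posE; lia.
  by apply: na; lia.
have := count_size (fun q => pred1 j (nth 0 v q)) (iota (A + (c.+1 - a) + (L - c.+1) + a) (c - a)).
have -> : count (fun q => pred1 j.+1 (nth 0 v q)) (iota A (c.+1 - a)) = c.+1 - a.
  rewrite -[RHS](size_iota A); apply/eqP; rewrite -all_count; apply/allP => q.
  rewrite mem_iota /A pE => hq.
  have -> : q = pos lam r.+1 (q - pos lam r.+1 0) by rewrite [RHS]pE; lia.
  by rewrite /= va1; lia.
by rewrite size_iota; lia.
Qed.

(** * Row insertion *)

Lemma set_nth_cat (r1 : seq nat) y r2 x :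
  set_nth 0 (r1 ++ y :: r2) (size r1) x = r1 ++ x :: r2.
Proof. by elim: r1 => //= a r1 ->. Qed.

Lemma bump_split (r : seq nat) x : sorted leq r -> uniq (x :: r) ->
  find (fun y => x < y) r < size r ->
  exists r1 y r2, [/\ r = r1 ++ y :: r2, find (fun y => x < y) r = size r1,
    x < y, {in r1, forall z, z < x} & {in r2, forall z, y < z}].
Proof.
move=> rs /= /andP[xr ru] hk; set k := find _ _ in hk *.
have er : r = take k r ++ nth 0 r k :: drop k.+1 r.
  by rewrite -drop_nth // cat_take_drop.
exists (take k r), (nth 0 r k), (drop k.+1 r); split=> //.
- by rewrite size_takel // ltnW.
- by apply: (@nth_find _ 0 (fun y => x < y)); rewrite has_find.
- move=> z zr; have /(nthP 0)[q] := zr; rewrite size_takel ?(ltnW hk) // => hq.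
  rewrite nth_take // => ez; have := before_find 0 hq; rewrite ez => h.
  have zr' := mem_take zr.
  by rewrite ltn_neqAle leqNgt h andbT; apply: contraNneq xr => <-.
- move=> z zr; rewrite er in rs; rewrite er in ru.
  have /allP/(_ z zr) := order_path_min leq_trans (subseq_sorted leq_trans (suffix_subseq _ _) rs).
  rewrite leq_eqVlt => /orP[/eqP e|//].
  by move: ru; rewrite cat_uniq /= e zr !andbF.
Qed.

(** The subword on two consecutive values decides whether [d] is a descent, and it is invariant
    under row insertion. *)
Definition pair_filter (d : nat) (w : seq nat) := [seq z <- w | (z == d) || (z == d.+1)].

Lemma pair_filter_cat d u v : pair_filter d (u ++ v) = pair_filter d u ++ pair_filter d v.
Proof. exact: filter_cat. Qed.

Lemma pair_filter0 d u : {in u, forall z, (z < d) || (d.+1 < z)} -> pair_filter d u = [::].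
Proof.
move=> h; rewrite /pair_filter -(filter_pred0 u); apply: eq_in_filter => z /h /=; lia.
Qed.

(* An elementary Knuth transformation never exchanges consecutive values. *)
Lemma pair_filter_bump d r1 x y r2 : x < y ->
  {in r1, forall z, z < x} -> {in r2, forall z, y < z} ->
  pair_filter d ([:: y] ++ r1 ++ [:: x] ++ r2) = pair_filter d (r1 ++ [:: y] ++ r2 ++ [:: x]).
Proof.
move=> xy h1 h2; rewrite !pair_filter_cat.
have Hy : pair_filter d [:: y] = [::] \/ pair_filter d r1 = [::].
  have [hy|hy] := boolP ((y == d) || (y == d.+1)).
    by right; apply: pair_filter0 => z /h1; lia.
  by left; apply: pair_filter0 => z; rewrite inE => /eqP ->; lia.
have Hx : pair_filter d [:: x] = [::] \/ pair_filter d r2 = [::].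
  have [hx|hx] := boolP ((x == d) || (x == d.+1)).
    by right; apply: pair_filter0 => z /h2; lia.
  by left; apply: pair_filter0 => z; rewrite inE => /eqP ->; lia.
by case: Hy => ->; case: Hx => ->; rewrite ?cats0 ?cat0s.
Qed.

(** A bump changes [r1 ++ [:: y] ++ r2 ++ [:: x]] into [[:: y] ++ r1 ++ [:: x] ++ r2], to which
    [pair_filter_bump] applies; [y] is then inserted into the rows above. *)
Lemma ins_rows_inv t x : all (sorted leq) t -> uniq (x :: flatten t) ->
  [/\ all (sorted leq) (ins_rows t x),
      perm_eq (flatten (ins_rows t x)) (x :: flatten t) &
      forall d, pair_filter d (rowword (ins_rows t x)) = pair_filter d (rowword t ++ [:: x])].
Proof.
elim: t x => [|r t IHt] x; first by [].
rewrite [all _ _]/= => /andP[rs ts] xu.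
have ru : uniq (x :: r).
  by move: xu; rewrite /= mem_cat cat_uniq negb_or => /andP[/andP[-> _] /andP[-> _]].
have ut : uniq (flatten t) by move: xu; rewrite /= cat_uniq => /and4P[].
rewrite [ins_rows _ _]/=; case: ifP => hk; last first.
  have hx z : z \in r -> z <= x.
    move=> zr; rewrite leqNgt; apply/negP => xz.
    by move: hk; rewrite -has_find => /hasP; apply; exists z.
  split.
  - rewrite /= ts andbT; case: (r) rs hx => //= a s hp hx.
    by rewrite rcons_path hp hx //= mem_last.
  - by rewrite /= cat_rcons -cat1s -[x :: _]cat1s perm_catCA.
  - by move=> d; rewrite !rowword_cons -cats1 catA.
have [r1 [y [r2 [er ek xy h1 h2]]]] := bump_split rs ru hk.
have e1 : set_nth 0 r (size r1) x = r1 ++ x :: r2 by rewrite er set_nth_cat.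
have e2 : nth 0 r (size r1) = y by rewrite er nth_cat ltnn subnn.
rewrite ek e1 e2 /=.
have yu : uniq (y :: flatten t).
  rewrite /= ut andbT; move: xu; rewrite /= er cat_uniq => /and4P[_ _ /hasPn h _].
  apply/negP => /h /=; by rewrite mem_cat inE eqxx orbT.
have [IH1 IH2 IH3] := IHt y ts yu; split.
- rewrite IH1 andbT; move: rs; rewrite er !(sorted_pairwise leq_trans) !pairwise_cat /=.
  rewrite !allrel_consr => /and3P[/andP[_ ->] -> /andP[_ ->]]; rewrite ?andbT /=.
  apply/andP; split; first by apply/allP => z /h1 /ltnW.
  by apply/allP => z /h2 yz; apply: ltnW (ltn_trans xy yz).
- apply: (@perm_trans _ ((r1 ++ x :: r2) ++ y :: flatten t)); first by rewrite perm_cat2l.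
  rewrite er; apply/permP => P; rewrite /= !count_cat /=; lia.
- move=> d; rewrite !rowword_cons pair_filter_cat IH3 er -pair_filter_cat -!catA.
  rewrite !(pair_filter_cat d (rowword t)); congr cat; exact: pair_filter_bump.
Qed.

Lemma rsk_P_inv w : uniq w ->
  [/\ all (sorted leq) (rsk_P w), perm_eq (flatten (rsk_P w)) w
    & forall d, pair_filter d (rowword (rsk_P w)) = pair_filter d w].
Proof.
rewrite /rsk_P; elim/last_ind: w => [|w x IHw]; first by [].
rewrite rcons_uniq => /andP[xw wu]; have [h1 h2 h3] := IHw wu.
rewrite foldl_rcons; set t := foldl _ _ _ in h1 h2 h3 *.
have xu : uniq (x :: flatten t) by rewrite /= (perm_mem h2) xw (perm_uniq h2).
have [g1 g2 g3] := ins_rows_inv h1 xu; split=> //.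
  by rewrite (perm_trans g2) // -cats1 perm_sym perm_catC perm_cons perm_sym.
by move=> d; rewrite g3 -cats1 !pair_filter_cat h3.
Qed.

Lemma subseq2_index (w : seq nat) a b : a \in w -> b \in w -> index a w < index b w ->
  subseq [:: a; b] w.
Proof.
move=> ha hb hab; rewrite -(cat_take_drop (index b w) w) -[[:: a; b]]/([:: a] ++ [:: b]).
apply: cat_subseq; first by rewrite sub1seq in_take.
by rewrite sub1seq (drop_nth 0) ?index_mem // nth_index // mem_head.
Qed.

(** Phrased by subsequences, a descent depends only on [pair_filter d w]. *)
Lemma desw_subseq w d : uniq w -> d \in w -> d.+1 \in w ->
  desw w d = subseq [:: d.+1; d] w.
Proof.
move=> wu hd hd1; have [h|h] := ltnP (index d.+1 w) (index d w).
  by rewrite /desw h subseq2_index.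
rewrite /desw ltnNge h /=; apply/esym/negbTE/negP => /(subseq_uniqP wu) e1.
have lt : index d w < index d.+1 w.
  rewrite ltn_neqAle h andbT; apply/eqP => e.
  by have := nth_index 0 hd1; rewrite -e nth_index //; lia.
have /(subseq_uniqP wu) := subseq2_index hd hd1 lt.
rewrite (eq_filter (a2 := mem [:: d.+1; d])) => [|z]; last by rewrite !inE orbC.
by rewrite -e1 => -[]; lia.
Qed.

Lemma eq_pair_filter_subseq d w w' : pair_filter d w = pair_filter d w' ->
  subseq [:: d.+1; d] w = subseq [:: d.+1; d] w'.
Proof.
move=> e; have aux u : subseq [:: d.+1; d] (pair_filter d u) = subseq [:: d.+1; d] u.
  by rewrite subseq_filter /= !eqxx orbT.
by rewrite -aux e aux.
Qed.

(** The prescribed tableau has reading word [i + m + 1, ..., i + 2m, i, ..., i + m], with sole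
    descent [i + m]; insertion keeps the order of [d] and [d.+1]. *)
Lemma dyck_interval_desw N w i m : perm_eq w (iota 1 N) -> dyck_interval w i m ->
  forall d, i <= d < i + 2 * m -> desw w d = (d == i + m).
Proof.
move=> wp /and4P[m0 i0 hN /eqP hP] d hd; rewrite (size_perm_iota wp) in hN.
have wu := uniq_perm_iota wp; set u := filter _ w in hP.
have [_ _ /(_ d)] := rsk_P_inv (filter_uniq (fun x => i <= x <= i + 2 * m) wu).
rewrite -/u hP => /eq_pair_filter_subseq.
rewrite subseq_filter /=.
have -> : i <= d <= i + 2 * m by lia.
have -> : i <= d.+1 <= i + 2 * m by lia.
rewrite (desw_subseq wu) ?(mem_perm_iota wp) //=; try lia.
have -> : rowword [:: iota i m.+1; iota (i + m).+1 m] = iota (i + m).+1 m ++ iota i m.+1.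
  by rewrite !rowword_cons.
move=> <-; rewrite -desw_subseq; last first.
- by rewrite mem_cat !mem_iota; lia.
- by rewrite mem_cat !mem_iota; lia.
- by rewrite cat_uniq !iota_uniq andbT; apply/hasPn => z; rewrite !mem_iota; lia.
rewrite /desw !index_cat !mem_iota.
have ind a n x : a <= x < a + n -> index x (iota a n) = x - a.
  move=> h; have e : nth 0 (iota a n) (x - a) = x by rewrite nth_iota; lia.
  by rewrite -{1}e index_uniq ?size_iota ?iota_uniq //; lia.
by rewrite size_iota; case: ifP => h1; case: ifP => h2; rewrite !ind; lia.
Qed.

(* State of the insertion of a shuffle of [i, i+1, ...] and [e+1, e+2, ...] after [k] letters
   of the first kind and [l] of the second, [s] of which have been bumped. *)
Definition two_row (i e k l s : nat) : tableau :=
  if k + l == 0 then [::]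
  else if s == 0 then [:: iota i k ++ iota e.+1 l]
  else [:: iota i k ++ iota (e.+1 + s) (l - s); iota e.+1 s].

Lemma rcons_iota a n : rcons (iota a n) (a + n) = iota a n.+1.
Proof. by rewrite -cats1 -[n.+1]addn1 iotaD. Qed.

Lemma find_none (r : seq nat) x : {in r, forall z, z <= x} -> find (fun y => x < y) r = size r.
Proof.
move=> h; apply/eqP; rewrite eqn_leq find_size leqNgt -has_find.
by apply/negP => /hasP[z /h]; lia.
Qed.

Lemma ins_two_row_high i e k l s : s <= l -> i + k <= e.+1 ->
  ins_rows (two_row i e k l s) (e.+1 + l) = two_row i e k l.+1 s.
Proof.
move=> sl ke; rewrite /two_row addnS /=.
case: eqP => [e0|_].
  have [-> -> ->] : [/\ s = 0, k = 0 & l = 0] by split; lia.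
  by rewrite /= addn0.
case: (eqVneq s 0) => [s0|s0] /=.
  rewrite find_none ?ltnn => [|z]; last by rewrite mem_cat !mem_iota; lia.
  by rewrite rcons_cat rcons_iota.
rewrite find_none ?ltnn => [|z]; last by rewrite mem_cat !mem_iota; lia.
rewrite rcons_cat (_ : e.+1 + l = e.+1 + s + (l - s)); last by lia.
by rewrite rcons_iota subSn.
Qed.

(** A low letter bumps the first high letter left in the bottom row, namely [e.+1 + s], which lands
    at the end of the top row. *)
Lemma ins_two_row_low i e k l s : s <= l -> i + k <= e ->
  ins_rows (two_row i e k l s) (i + k) = two_row i e k.+1 l (if s < l then s.+1 else s).
Proof.
move=> sl ke; rewrite /two_row addSn /=.
case: eqP => [e0|nz].
  have [-> -> ->] : [/\ s = 0, k = 0 & l = 0] by split; lia.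
  by rewrite /= addn0.
have bump : s < l -> forall t, ins_rows ((iota i k ++ iota (e.+1 + s) (l - s)) :: t) (i + k)
   = (iota i k.+1 ++ iota (e.+1 + s.+1) (l - s.+1)) :: ins_rows t (e.+1 + s).
  move=> hs t; have -> : l - s = (l - s.+1).+1 by lia.
  rewrite /= find_cat (_ : has _ _ = false); last first.
    by apply/hasP => -[z]; rewrite mem_iota; lia.
  rewrite /= (_ : i + k < e.+1 + s); last by lia.
  rewrite addn0 size_cat /= addnS ltnS leq_addr.
  have := set_nth_cat (iota i k) (e.+1 + s) (iota (e.+1 + s).+1 (l - s.+1)) (i + k).
  rewrite size_iota => ->; rewrite nth_cat size_iota ltnn subnn /=.
  by rewrite -[i :: _]/(iota i k.+1 ++ _) -rcons_iota cat_rcons addnS.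
case: (ltnP s l) => hs.
  case: (eqVneq s 0) => [s0|s0].
    move: (bump hs [::]); rewrite s0 addn0 subn0 => ->.
    by rewrite /= addn1.
  by rewrite bump //= find_none ?size_iota ?ltnn ?rcons_iota // => z; rewrite mem_iota; lia.
have {hs sl} -> : s = l by lia.
have nobump t : ins_rows (iota i k :: t) (i + k) = iota i k.+1 :: t.
  rewrite [LHS]/= find_none ?ltnn ?rcons_iota // => z; rewrite mem_iota; lia.
case: (eqVneq l 0) => [->|l0]; first by rewrite [iota e.+1 0]/= !cats0 nobump.
by rewrite subnn [iota _ 0]/= !cats0 nobump.
Qed.

(** Insertion performs the bracketing: the [l - s] high letters left in the bottom row are the open
    brackets, a high letter adds one and a low letter bumps one away. *)
Lemma foldl_two_row i e (g : nat -> nat) u k l s : s <= l ->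
  (forall x, x \in u -> g x = if x <= e then i else i.+1) ->
  i + k + size [seq x <- u | x <= e] <= e.+1 ->
  [seq x <- u | x <= e] = iota (i + k) (size [seq x <- u | x <= e]) ->
  [seq x <- u | e < x] = iota (e.+1 + l) (size [seq x <- u | e < x]) ->
  let l' := l + size [seq x <- u | e < x] in
  foldl ins_rows (two_row i e k l s) u
    = two_row i e (k + size [seq x <- u | x <= e]) l' (l' - opn i (map g u) (l - s)).
Proof.
elim: u k l s => [|x u IHu] k l s sl /= hg hsz hlo hhi.
  by rewrite !addn0; congr two_row; lia.
have hx := hg x (mem_head _ _); have hg' y : y \in u -> g y = if y <= e then i else i.+1.
  by move=> yu; apply: hg; rewrite inE yu orbT.
have i1 : i == i.+1 = false by lia.
case: (leqP x e) hx hlo hhi hsz => xe -> /=; rewrite ?xe ?(ltnNge e) ?xe /= ?eqxx.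
  move=> [-> hlo] hhi hsz; rewrite i1 ins_two_row_low //; last by lia.
  have hs : (if s < l then s.+1 else s) <= l by case: ifP; lia.
  rewrite IHu //; [|lia|by rewrite addnS].
  rewrite addnS addSn; congr (two_row _ _ _ _ (_ - opn _ _ _)).
  by case: ifP; lia.
move=> hlo [-> hhi] hsz; rewrite ins_two_row_high //; last by lia.
rewrite IHu //; [|lia|by rewrite addnS].
by rewrite addSn addnS (subSn sl).
Qed.

(** * Dyck pattern intervals and crystal edges *)

Lemma count_ge (P : pred nat) (s : seq nat) a n :
  (forall x, a <= x < a + n -> (x \in s) && P x) -> n <= count P s.
Proof.
move=> h; rewrite -size_filter -[n](size_iota a); apply: uniq_leq_size; first exact: iota_uniq.
by move=> x; rewrite mem_iota mem_filter => /h; rewrite andbC.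
Qed.

Lemma count_le (P : pred nat) (s : seq nat) a n : uniq s ->
  (forall x, x \in s -> P x -> a <= x < a + n) -> count P s <= n.
Proof.
move=> us h; rewrite -size_filter -[n](size_iota a); apply: uniq_leq_size.
  exact: filter_uniq.
by move=> x; rewrite mem_iota mem_filter => /andP[Px xs]; apply: h.
Qed.

Lemma leq_in_count (P Q : pred nat) (s : seq nat) :
  (forall x, x \in s -> P x -> Q x) -> count P s <= count Q s.
Proof.
elim: s => //= x s IHs h; apply: leq_add; last first.
  by apply: IHs => y ys; apply: h; rewrite inE ys orbT.
by have := h x (mem_head _ _); case: (P x) => // ->.
Qed.

Lemma cnt_map (g : nat -> nat) y w : cnt y (map g w) = count (fun x => g x == y) w.
Proof. exact: count_map. Qed.

Definition colf (i m x : nat) : nat :=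
  if i <= x <= i + m then i else if i + m < x <= i + 2 * m then i.+1 else x.

Lemma colf_low i m x : 0 < m -> (colf i m x == i) = (i <= x <= i + m).
Proof. by rewrite /colf => m0; case: ifP => h1; [|case: ifP => h2]; lia. Qed.

(** Since [m] is positive, the value [i.+1] itself belongs to the low half, so no letter outside the
    window is sent to [i.+1]. *)
Lemma colf_high i m x : 0 < m -> (colf i m x == i.+1) = (i + m < x <= i + 2 * m).
Proof. by rewrite /colf => m0; case: ifP => h1; [|case: ifP => h2]; lia. Qed.

Lemma lexle_set_nth v p a q r : q != p -> r != p ->
  lexle (set_nth 0 v p a) q r = lexle v q r.
Proof. by move=> qp rp; rewrite /lexle !nth_set_nth /= (negbTE qp) (negbTE rp). Qed.

Lemma lexle_set_nth_l v p a r : r != p ->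
  lexle (set_nth 0 v p a) p r = (a < nth 0 v r) || (a == nth 0 v r) && (p <= r).
Proof. by move=> rp; rewrite /lexle !nth_set_nth /= eqxx (negbTE rp). Qed.

(** * Collapsing a window that lies in two consecutive blocks *)

Section Window.

Variables (N : nat) (w : seq nat).
Hypothesis w_perm : perm_eq w (iota 1 N).

Lemma mem_segment x a b : (x \in drop a (take b w)) = (0 < x <= N) && (a <= index x w < b).
Proof.
have sw := size_perm_iota w_perm; apply/idP/idP.
  case/(nthP 0)=> q; rewrite size_drop size_take_min sw => hq.
  have hN : a + q < N by lia.
  rewrite nth_drop nth_take; last by lia.
  by move=> <-; rewrite (nth_perm_iota w_perm hN) (index_nth_perm w_perm hN); lia.
case/andP=> hx hi; have hN := index_perm_lt w_perm hx.
have -> : x = nth 0 (drop a (take b w)) (index x w - a).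
  by rewrite nth_drop nth_take ?subnKC ?(nth_index_perm w_perm) //; lia.
by rewrite mem_nth // size_drop size_take_min sw; lia.
Qed.

Variables (i m : nat).
Hypotheses (i_gt0 : 0 < i) (m_gt0 : 0 < m) (im_le : i + 2 * m <= N).
Variable j : nat.
Hypothesis bi_low : forall x, i <= x <= i + m -> bi w x = j.
Hypothesis bi_high : forall x, i + m < x <= i + 2 * m -> bi w x = j.+1.

Lemma lexle_colf p q : p < N -> q < N ->
  lexle (map (colf i m) w) q p = (nth 0 w q <= nth 0 w p).
Proof.
apply: (lexle_map w_perm) => x y x0 xy.
  by rewrite /colf; do ?case: ifP; lia.
have := @bi_eq_index _ _ w_perm x y x0 xy => h e; apply: h; move: e.
rewrite /colf; case: ifP => h1; [|case: ifP => h2]; case: ifP => h3; try lia.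
- by move=> _; rewrite !bi_low.
- by case: ifP; lia.
- by case: ifP => h4; [rewrite !bi_high | lia].
- by case: ifP; lia.
Qed.

Section SamePosition.

Variable p : nat.
Hypotheses (p_lt : p < N) (p_low : i <= nth 0 w p <= i + m).
Hypothesis extra_after : forall y, i + 2 * m < y <= N -> bi w y = j.+1 -> p < index y w.

(** Only comparisons with [p] can differ. Letters of block [j.+1] beyond the window exceed [i.+1] in
    the collapsed word; in the other word they tie with the new [j.+1], but lie to its right, so
    they are larger there too. *)
Lemma std_collapse : std_word (set_nth 0 (map (colf i m) w) p i.+1)
                   = std_word (set_nth 0 (map (bi w) w) p j.+1).
Proof.
have sw := size_perm_iota w_perm.
have ssz g a : size (set_nth 0 (map g w) p a) = N by rewrite size_set_nth size_map sw; lia.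
have key r : r < N -> r != p -> lexle (set_nth 0 (map (colf i m) w) p i.+1) p r
                  = lexle (set_nth 0 (map (bi w) w) p j.+1) p r.
  move=> hr rp; rewrite !lexle_set_nth_l // !(nth_map 0) ?sw //.
  have := nth_perm_iota w_perm hr; have := index_nth_perm w_perm hr.
  set y := nth 0 w r => iy hy.
  have h0 : y <= i + m -> bi w y <= j.
    by move=> h; rewrite -(bi_low (x := i + m)); [apply: bi_homo|]; lia.
  have h1 := @bi_high y; have h2 := extra_after (y := y).
  have h3 : i + 2 * m < y -> j < bi w y.
    by move=> h; rewrite -(bi_high (x := i + 2 * m)); [apply: bi_homo|]; lia.
  by rewrite /colf; case: ifP => c1; [|case: ifP => c2]; lia.
apply: eq_std_word; rewrite !ssz // => r q hr hq.
have [->|qp] := eqVneq q p; have [->|rp] := eqVneq r p.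
- by rewrite /lexle !eqxx !leqnn !orbT.
- exact: key.
- by rewrite lexle_anti 1?eq_sym // key // -lexle_anti 1?eq_sym.
- rewrite !lexle_set_nth // lexle_colf //; apply/esym/(lexle_map w_perm) => //.
    by move=> x y x0 xy; apply: bi_homo => //; lia.
  exact: (bi_eq_index w_perm).
Qed.

(** Every [j.+1] before [p] lies in the window by [extra_after]; every [j] after [p] does so because
    positions increase within a block. Letters outside the window only help the two inequalities. *)
Lemma uncollapse_unbracketed : rightmost_unbracketed i (map (colf i m) w) p ->
  rightmost_unbracketed j (map (bi w) w) p.
Proof.
have sw := size_perm_iota w_perm; have ip := index_nth_perm w_perm p_lt.
case; rewrite size_map sw => _ _ hsuf hpre; split; rewrite ?size_map ?sw //.
- by rewrite (nth_map 0) ?sw // bi_low.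
- move=> s; have := hsuf s; rewrite -!map_take -!map_drop !cnt_map => h.
  apply: (@leq_trans (count (fun x => colf i m x == i.+1) (drop s (take p w)))).
    apply: leq_in_count => x /=; rewrite mem_segment => /andP[xN hx] /eqP bx.
    rewrite colf_high //; have := extra_after (y := x).
    have := @bi_low x; have := @bi_homo w x i; have := bi_low (x := i); lia.
  apply: leq_trans h _; apply: sub_count => x /=; rewrite colf_low // => /bi_low ->.
  exact: eqxx.
- move=> s; have := hpre s; rewrite -!map_drop -!map_take !cnt_map take_drop => h.
  apply: (@leq_trans (count (fun x => colf i m x == i) (drop p.+1 (take (s + p.+1) w)))).
    apply: leq_in_count => x /=; rewrite mem_segment => /andP[xN hx] /eqP bx.
    rewrite colf_low //.
    have h1 : x <= i + m.
      rewrite leqNgt; apply/negP => h1.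
      have := @bi_homo w (i + m).+1 x isT h1; rewrite (bi_high (x := (i + m).+1)); lia.
    rewrite h1 andbT leqNgt; apply/negP => h2.
    have := @bi_eq_index _ _ w_perm x (nth 0 w p); rewrite ip bx bi_low //; lia.
  apply: leq_trans h _; apply: sub_count => x /=; rewrite colf_high // => /bi_high ->.
  exact: eqxx.
Qed.

End SamePosition.

End Window.

(* If a letter [j.+1] beyond the window preceded the letter at [p], the edge would create the
   new descent [i + 2 * m] while only moving the descent [i + m] to [i + m - 1]. *)
Lemma extra_letters_after N w i m j p :
  perm_eq w (iota 1 N) -> 0 < i -> 0 < m -> i + 2 * m <= N ->
  (forall x, i <= x <= i + m -> bi w x = j) ->
  (forall x, i + m < x <= i + 2 * m -> bi w x = j.+1) ->
  rightmost_unbracketed i (map (colf i m) w) p ->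
  bi (std_word (set_nth 0 (map (colf i m) w) p i.+1)) N <= bi w N ->
  forall y, i + 2 * m < y <= N -> bi w y = j.+1 -> p < index y w.
Proof.
move=> wp i0 m0 imN bl bh [hp cp hsuf _] hbi y hy by1.
have sw := size_perm_iota wp; rewrite size_map sw in hp.
have ip := index_nth_perm wp hp; have x0N := nth_perm_iota wp hp.
move: cp; rewrite (nth_map 0) ?sw // => /eqP; rewrite colf_low //.
set x0 := nth 0 w p in ip x0N * => hx0.
rewrite ltnNge; apply/negP => hyp.
have {}hyp : index y w < p.
  rewrite ltn_neqAle hyp andbT; apply/eqP => e.
  by have := @index_perm_inj _ _ wp y x0; rewrite e ip; lia.
have ord := bi_eq_index wp.
have zy z : i + m < z <= i + 2 * m -> index z w < index y w.
  by move=> hz; have := ord z y; rewrite (bh z hz) by1; lia.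
have ulow x z : i <= x -> x < z <= i + m -> index x w < index z w.
  by move=> h1 h2; have := ord x z; rewrite !bl; lia.
have seg s : cnt i.+1 (drop s (take p (map (colf i m) w))) <=
             cnt i (drop s (take p (map (colf i m) w))) := hsuf s.
have useg s : uniq (drop s (take p w)) by rewrite drop_uniq ?take_uniq ?(uniq_perm_iota wp).
(* All [m] high letters precede [p], so [m] low letters do as well, and these are smaller than
   [x0]. *)
have ex0 : x0 = i + m.
  have := seg 0; rewrite -!map_take -!map_drop !cnt_map => h.
  have h1 : m <= count (fun x => colf i m x == i.+1) (drop 0 (take p w)).
    apply: (@count_ge _ _ (i + m).+1) => z hz; rewrite colf_high // (mem_segment wp).
    have := zy z; lia.
  have h2 : count (fun x => colf i m x == i) (drop 0 (take p w)) <= x0 - i.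
    apply: (@count_le _ _ i) => // z; rewrite (mem_segment wp) colf_low // => hz1 hz2.
    have [hlt|hgt|heq] := ltngtP z x0; first by lia.
      by have := ulow x0 z; rewrite ip; lia.
    by move: hz1; rewrite heq ip; lia.
  by have := leq_trans h1 (leq_trans h h2); lia.
(* Otherwise the segment from the first high letter to [p] would contain all [m] high letters and no
   low one. *)
have ord_mid : index (i + m).+1 w < index (i + m).-1 w.
  rewrite ltnNge; apply/negP => hle; set s := index (i + m).+1 w in hle *.
  have := seg s; rewrite -!map_take -!map_drop !cnt_map => h.
  have h1 : m <= count (fun x => colf i m x == i.+1) (drop s (take p w)).
    apply: (@count_ge _ _ (i + m).+1) => z hz; rewrite colf_high // (mem_segment wp).
    have : s <= index z w.
      have [->|ne] := eqVneq z (i + m).+1; first exact: leqnn.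
      by have := ord (i + m).+1 z; rewrite -/s !bh; lia.
    have := zy z; lia.
  have h2 : count (fun x => colf i m x == i) (drop s (take p w)) <= 0.
    apply: (@count_le _ _ 0) => // z; rewrite (mem_segment wp) colf_low // => hz1 hz2.
    have zne : z <> i + m by move=> e; move: hz1; rewrite e -ex0 ip; lia.
    have : index z w <= s.
      have [->//|ne] := eqVneq z (i + m).-1.
      by apply: leq_trans hle; apply: ltnW; apply: ulow; lia.
    have := @index_perm_inj _ _ wp z (i + m).+1; rewrite -/s; lia.
  by have := leq_trans h1 (leq_trans h h2); lia.
(* Effect of the edge on values: the letter at [p] becomes the last [i.+1], so [i + m] moves to
   [i + 2 * m] and the high values drop by one. *)
pose sg x := if x == i + m then i + 2 * m else if i + m < x <= i + 2 * m then x.-1 else x.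
have sg_inj : injective sg by move=> a b; rewrite /sg; repeat (case: ifP => ?); lia.
have sgw : std_word (set_nth 0 (map (colf i m) w) p i.+1) = map sg w.
  have sgp : perm_eq (map sg w) (iota 1 N).
    have u : uniq (map sg w) by rewrite map_inj_uniq ?(uniq_perm_iota wp).
    apply: uniq_perm; rewrite ?iota_uniq //.
    have sub : {subset map sg w <= iota 1 N}.
      move=> z /mapP[x xw ->]; rewrite (mem_perm_iota wp) in xw; rewrite mem_iota.
      by rewrite /sg; repeat (case: ifP => ?); lia.
    by have [] := uniq_min_size u sub; rewrite ?size_map ?sw ?size_iota.
  apply: (std_wordP sgp); first by rewrite size_set_nth size_map sw; lia.
  have key r : r < N -> r != p ->
      lexle (set_nth 0 (map (colf i m) w) p i.+1) p r = (sg x0 <= nth 0 (map sg w) r).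
    move=> hr rp; rewrite lexle_set_nth_l // !(nth_map 0) ?sw //.
    have ir := index_nth_perm wp hr; set z := nth 0 w r in ir *.
    have zx0 : z <> x0 by move=> e; move: ir; rewrite e ip => h; rewrite h eqxx in rp.
    have := zy z; rewrite ir ex0 /sg eqxx /colf.
    by repeat (case: ifP => ?); lia.
  move=> r q hr hq; have [->|qp] := eqVneq q p; have [->|rp] := eqVneq r p.
  - by rewrite /lexle !eqxx !leqnn !orbT.
  - by rewrite key // (nth_map 0 0 sg (n := p)) ?sw.
  - rewrite lexle_anti 1?eq_sym // key // -ltnNge ltn_neqAle.
    rewrite !(nth_map 0) ?sw // -/x0 (inj_eq sg_inj).
    suff -> : nth 0 w q != x0 by [].
    by apply: contra_neq qp => e; rewrite -(index_nth_perm wp hq) e ip.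
  - rewrite lexle_set_nth // (lexle_colf wp i0 m0 imN bl bh) // !(nth_map 0) ?sw //.
    have zne t : t < N -> t != p -> nth 0 w t <> i + m.
      move=> ht tp e; move: tp; rewrite -(index_nth_perm wp ht) e -ex0 ip eqxx //.
    have := zne q hq qp; have := zne r hr rp; rewrite /sg.
    by repeat (case: ifP => ?); lia.
rewrite sgw in hbi; pose w' := map sg w.
have ind x : index (sg x) w' = index x w by rewrite /w' index_map.
have des_out d : 0 < d < i \/ i + 2 * m < d -> desw w' d = desw w d.
  move=> hd; have e1 : sg d = d by rewrite /sg; repeat (case: ifP => ?); lia.
  have e2 : sg d.+1 = d.+1 by rewrite /sg; repeat (case: ifP => ?); lia.
  by have := ind d; have := ind d.+1; rewrite /desw e1 e2 => -> ->.
have d1 : desw w' (i + m).-1.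
  rewrite /desw; have -> : (i + m).-1.+1 = sg (i + m).+1 by rewrite /sg; repeat (case: ifP => ?); lia.
  have e : sg (i + m).-1 = (i + m).-1 by rewrite /sg; repeat (case: ifP => ?); lia.
  by have := ind (i + m).-1; rewrite e ind => ->.
have bnext : bi w (i + 2 * m).+1 = j.+1.
  have := @bi_homo w (i + 2 * m) (i + 2 * m).+1; have := @bi_homo w (i + 2 * m).+1 y.
  rewrite by1 (bh (i + 2 * m)); lia.
have d2 : desw w' (i + 2 * m).
  rewrite /desw; have e : sg (i + 2 * m).+1 = (i + 2 * m).+1 by rewrite /sg; repeat (case: ifP => ?); lia.
  have e2 : sg x0 = i + 2 * m by rewrite /sg ex0 eqxx.
  have := ind (i + 2 * m).+1; have := ind x0; rewrite e e2 ip => -> ->.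
  apply: leq_ltn_trans hyp.
  by apply: bi_eq_index_le; rewrite ?bnext ?by1 //; lia.
have d3 : desw w (i + 2 * m) = false.
  by have := @biS w (i + 2 * m); rewrite bnext (bh (i + 2 * m)); lia.
have d4 d : i <= d < i + 2 * m -> desw w d -> d = i + m.
  move=> hd dd; have := @biS w d; rewrite dd.
  have := bl d; have := bl d.+1; have := bh d; have := bh d.+1; lia.
move: hbi; rewrite -/w' /bi ltnS.
(* Compare descents piecewise: the outer pieces agree, the window has at most one in [w] and at
   least one in [w'], and [i + 2 * m] is a descent of [w'] only. *)
have -> : N.-1 = i.-1 + (2 * m + (1 + (N.-1 - (i + 2 * m)))) by lia.
rewrite (iotaD _ i.-1) (iotaD _ (2 * m)) (iotaD _ 1) !count_cat (_ : 1 + i.-1 = i); last by lia.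
rewrite [count (desw w') (iota 1 _)](@eq_in_count _ _ (desw w)) => [|d]; last first.
  by rewrite mem_iota => hd; apply: des_out; lia.
rewrite [count (desw w') (iota (i + 2 * m + 1) _)](@eq_in_count _ _ (desw w)) => [|d]; last first.
  by rewrite mem_iota => hd; apply: des_out; lia.
rewrite /= d2 d3.
have : count (desw w) (iota i (2 * m)) <= 1.
  apply: (@count_le _ _ (i + m)); first exact: iota_uniq.
  by move=> d; rewrite mem_iota => hd /d4; lia.
have : 0 < count (desw w') (iota i (2 * m)).
  by rewrite -has_count; apply/hasP; exists (i + m).-1; rewrite // mem_iota; lia.
set b' := count (desw w') (iota i _); set b := count (desw w) (iota i _).
set a := count _ (iota 1 _); set r := count _ (iota _ (_ - _)).
by lia.
Qed.

(** No bracket is open just before [p]; after [p] all letters [i] are bracketed and are no fewer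
    than the [i.+1]. So no bracket stays open at the end, and by [foldl_two_row] every high letter
    is bumped to the top row. *)
Lemma dyck_interval_intro N w i m p :
  perm_eq w (iota 1 N) -> 0 < i -> 0 < m -> i + 2 * m <= N ->
  (forall x y, i <= x -> x < y <= i + m -> index x w < index y w) ->
  (forall x y, i + m < x -> x < y <= i + 2 * m -> index x w < index y w) ->
  rightmost_unbracketed i (map (colf i m) w) p ->
  cnt i.+1 (drop p.+1 (map (colf i m) w)) <= cnt i (drop p.+1 (map (colf i m) w)) ->
  dyck_interval w i m.
Proof.
move=> wp i0 m0 imN olow ohigh /rightmost_unbracketedP[hp cp o1 c2] hcnt.
rewrite /dyck_interval m0 i0 (size_perm_iota wp) imN /=; apply/eqP.
set u := filter _ w; set c := map (colf i m) w in hp cp o1 c2 hcnt *.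
have opn0 : opn i c 0 = 0.
  rewrite -(cat_take_drop p c) opn_cat o1 (drop_nth 0 hp) cp /=.
  rewrite (_ : i == i.+1 = false) ?eqxx; last by lia.
  by have := closed_opn c2; lia.
have opnu : opn i (map (colf i m) u) 0 = 0.
  pose P z := (z == i) || (z == i.+1).
  have eu : u = filter (preim (colf i m) P) w.
    by apply: eq_in_filter => x _ /=; rewrite /P colf_low // colf_high //; lia.
  by rewrite eu -filter_map opn_filter ?opn0 // /P eqxx ?orbT.
have elow : [seq x <- u | x <= i + m] = iota i m.+1.
  rewrite -filter_predI; apply: (filter_perm_iota wp) => //=; try lia.
  by move=> x y h1 h2; apply: olow; lia.
have ehigh : [seq x <- u | i + m < x] = iota (i + m).+1 m.
  rewrite -filter_predI; apply: (filter_perm_iota wp) => //=; try lia.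
  by move=> x y h1 h2; apply: ohigh; lia.
have hg x : x \in u -> colf i m x = if x <= i + m then i else i.+1.
  by rewrite mem_filter /colf; repeat (case: ifP => ?); lia.
have := @foldl_two_row i (i + m) (colf i m) u 0 0 0 isT hg.
rewrite elow ehigh !size_iota !addn0 !add0n addnS => /(_ (leqnn _) erefl erefl).
rewrite -[two_row _ _ 0 0 0]/[::] -/(rsk_P u) => ->.
rewrite opnu subn0 /two_row addSn (negbTE (lt0n_neq0 m0)) subnn [iota _ 0]/= cats0 //.
Qed.

Lemma crystal_window N w lam j p : is_partition lam -> N = sumn lam ->
  perm_eq w (iota 1 N) -> ssyt_word lam w -> bi w N = size lam -> 0 < j < size lam ->
  rightmost_unbracketed j (map (bi w) w) p ->
  exists i m,
  [/\ [/\ 0 < i, 0 < m & i + 2 * m <= N], forall x, i <= x <= i + m -> bi w x = j,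
      forall x, i + m < x <= i + 2 * m -> bi w x = j.+1,
      [/\ p < N, i <= nth 0 w p <= i + m &
        forall y, i + 2 * m < y <= N -> bi w y = j.+1 -> p < index y w]
    & rightmost_unbracketed i (map (colf i m) w) p /\ dyck_interval w i m].
Proof.
move=> lam_part eN wp ws bl hj [hp vp hsuf hpre].
have sw := size_perm_iota wp; rewrite size_map sw in hp.
have ip := index_nth_perm wp hp; have x0N := nth_perm_iota wp hp.
move: vp; rewrite (nth_map 0) ?sw //; set x0 := nth 0 w p in ip x0N * => bx0.
have bih := @bi_homo w.
(* Blocks are intervals of values: below, block [j] is [[f + 1, e]] and block [j.+1] is
   [[e + 1, g]]. *)
have low k : exists2 e, e <= N & forall x, 0 < x <= N -> (bi w x <= k) = (x <= e).
  exists (count (fun x => bi w x <= k) (iota 1 N)).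
    by have := count_size (fun x => bi w x <= k) (iota 1 N); rewrite size_iota.
  move=> x hx; rewrite (@count_downclosed (fun x => bi w x <= k) 1 N) //.
  by move=> a b hab _ h; apply: leq_trans h; apply: bih; lia.
have [f fN hf] := low j.-1; have [e eN' he] := low j; have [g gN hg] := low j.+1.
have bij x : 0 < x <= N -> (bi w x == j) = (f < x <= e).
  by move=> hx; have := hf x hx; have := he x hx; lia.
have bij1 x : 0 < x <= N -> (bi w x == j.+1) = (e < x <= g).
  by move=> hx; have := hg x hx; have := he x hx; lia.
have fx0 : f < x0 <= e by rewrite -bij // bx0.
have ord := bi_eq_index wp.
have ordj x y : f < x -> x < y <= e -> index x w < index y w.
  move=> h1 h2; apply: ord; try lia.
  by have := bij x; have := bij y; lia.
have ordj1 x y : e < x -> x < y <= g -> index x w < index y w.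
  move=> h1 h2; apply: ord; try lia.
  by have := bij1 x; have := bij1 y; lia.
pose A := count (fun x => index x w < p) (iota e.+1 (g - e)).
have hA x : e < x <= g -> (index x w < p) = (x <= e + A).
  move=> hx; rewrite (@count_downclosed (fun x => index x w < p) e.+1 (g - e)) //; last by lia.
  move=> a b hab hb h; have [->//|ne] := eqVneq a b.
  by apply: ltn_trans h; apply: ordj1; lia.
have Ag : A <= g - e.
  by have := count_size (fun x => index x w < p) (iota e.+1 (g - e)); rewrite size_iota.
have useg a b : uniq (drop a (take b w)) by rewrite drop_uniq ?take_uniq ?(uniq_perm_iota wp).
have jbefore x : f < x <= e -> (index x w < p) = (x < x0).
  move=> hx; have := ordj x x0; have := ordj x0 x; rewrite ip.
  by have [?|?|e1] := ltngtP x x0; [lia|lia|rewrite e1 ip; lia].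
(* The [j.+1] of the first column precedes [p]; this makes [m] positive. *)
have A0 : 0 < A.
  have vs := ssyt_word_map_bi lam_part; rewrite -eN in vs.
  have {}vs := vs _ wp ws.
  have vr q : q < sumn lam -> 0 < nth 0 (map (bi w) w) q <= size lam.
    rewrite -eN => hq; rewrite (nth_map 0) ?sw // bi_gt0 -bl bih //;
    by have := nth_perm_iota wp hq; lia.
  have hj' : j < size lam by lia.
  have := first_column_before lam_part vs vr hj' (q := p); rewrite -eN.
  rewrite (nth_map 0) ?sw // -/x0 => /(_ hp bx0) hq.
  have hqN := ltn_trans hq hp.
  have := first_column lam_part vs vr hj'; rewrite (nth_map 0) ?sw //.
  have hyN := nth_perm_iota wp hqN; have iy := index_nth_perm wp hqN.
  set y := nth 0 w _ in hyN iy * => /eqP; rewrite bij1 // => hy.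
  by have := hA y hy; rewrite iy; lia.
(* The letters [j] before [p] are [f + 1, ..., x0 - 1], at least as many as the [A] letters [j.+1]
   there. Hence the window starts inside block [j]. *)
have Ax0 : A + f < x0.
  have := hsuf 0; rewrite -map_take -map_drop !cnt_map => h.
  have h1 : A <= count (fun x => bi w x == j.+1) (drop 0 (take p w)).
    apply: (@count_ge _ _ e.+1) => z hz; rewrite (mem_segment wp) bij1; last by lia.
    by have := hA z; lia.
  have h2 : count (fun x => bi w x == j) (drop 0 (take p w)) <= x0 - f.+1.
    apply: (@count_le _ _ f.+1) => // z; rewrite (mem_segment wp) => /andP[zN hz].
    by rewrite bij // => hz'; have := jbefore z hz'; lia.
  by have := leq_trans h1 (leq_trans h h2); lia.
(* The [e - x0] letters [j] after [p] are bracketed by letters [j.+1] after [p]; hence the window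
   ends inside block [j.+1]. *)
have Bg : e - x0 <= g - (e + A).
  have := hpre (size w); rewrite -map_drop -map_take take_drop !cnt_map => h.
  have h1 : e - x0 <= count (fun x => bi w x == j) (drop p.+1 (take (size w + p.+1) w)).
    apply: (@count_ge _ _ x0.+1) => z hz; rewrite (mem_segment wp) bij; last by lia.
    have zN : 0 < z <= N by lia.
    by have := index_perm_lt wp zN; have := ordj x0 z; rewrite ip sw; lia.
  have h2 : count (fun x => bi w x == j.+1) (drop p.+1 (take (size w + p.+1) w)) <= g - (e + A).
    apply: (@count_le _ _ (e + A).+1) => // z; rewrite (mem_segment wp) => /andP[zN hz].
    by rewrite bij1 // => hz'; have := hA z hz'; lia.
  exact: leq_trans h1 (leq_trans h h2).
(* The low half ends with block [j] and the window is balanced around [p]: [A] letters of each kind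
   before [p], and [e - x0] of each kind after. *)
pose i := x0 - A; pose m := A + (e - x0).
have im : i + m = e by rewrite /i /m; lia.
have i2m : i + 2 * m = e + m by rewrite -im; lia.
have mE : m = A + (e - x0) by [].
have iE : i = x0 - A by [].
clearbody i m.
have mg : e + m <= g by lia.
have if_ : f < i by lia.
have m0 : 0 < m by lia.
have blow x : i <= x <= i + m -> bi w x = j.
  by move=> hx; apply/eqP; rewrite bij; lia.
have bhigh x : i + m < x <= i + 2 * m -> bi w x = j.+1.
  by move=> hx; apply/eqP; rewrite bij1; lia.
have extra y : i + 2 * m < y <= N -> bi w y = j.+1 -> p < index y w.
  move=> hy /eqP; rewrite bij1; last by lia.
  move=> hy1; have := hA y hy1; have := @index_perm_inj _ _ wp y x0; rewrite ip; lia.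
have seg_low s x : x \in drop s (take p w) -> bi w x == j -> f < x < x0.
  rewrite (mem_segment wp) => /andP[xN hx]; rewrite bij // => hx'.
  by have := jbefore x hx'; lia.
have unb : rightmost_unbracketed i (map (colf i m) w) p.
  split; rewrite ?size_map ?sw //.
  - by rewrite (nth_map 0) ?sw //; apply/eqP; rewrite colf_low //; lia.
  - move=> s; have := hsuf s; rewrite -!map_take -!map_drop !cnt_map => h.
    (* A segment reaching a [j] below the window contains all [A] window letters [j] before [p],
       which suffice. Otherwise all its [j] lie in the window and [hsuf] applies. *)
    have [/hasP[y ys hy]|hn] := boolP (has (fun y => f < y < i) (drop s (take p w))).
      apply: (@leq_trans A).
        apply: (@count_le _ _ e.+1) => // z; rewrite (mem_segment wp) colf_high // => hz1 hz2.
        by have := hA z; lia.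
      apply: (@count_ge _ _ i) => z hz; rewrite colf_low // (mem_segment wp).
      rewrite (mem_segment wp) in ys.
      have := ordj y z; have := jbefore z; lia.
    apply: (@leq_trans (count (fun x => bi w x == j.+1) (drop s (take p w)))).
      by apply: leq_in_count => x _; rewrite colf_high // => /bhigh ->.
    apply: leq_trans h _; apply: leq_in_count => x xs bx; rewrite colf_low //.
    have := hasPn hn x xs; have := seg_low s x xs bx; lia.
  - move=> s; have := hpre s; rewrite -!map_drop -!map_take !cnt_map take_drop => h.
    set b := s + p.+1 in h *.
    (* Symmetrically, a segment reaching a [j.+1] beyond the window contains all [e - x0] window
       letters [j.+1] after [p]. *)
    have [/hasP[y ys hy]|hn] := boolP (has (fun y => e + m < y <= g) (drop p.+1 (take b w))).
      apply: (@leq_trans (e - x0)).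
        apply: (@count_le _ _ x0.+1) => // z; rewrite (mem_segment wp) colf_low // => hz1 hz2.
        have := jbefore z; have zx0 : z <> x0 by move=> e1; move: hz1; rewrite e1 ip; lia.
        by lia.
      apply: (@count_ge _ _ (e + A).+1) => z hz; rewrite colf_high // (mem_segment wp).
      rewrite (mem_segment wp) in ys.
      have zx0 : index z w <> p.
        by rewrite -ip => /(index_perm_inj wp); lia.
      have := ordj1 z y; have := hA z; lia.
    apply: (@leq_trans (count (fun x => bi w x == j) (drop p.+1 (take b w)))).
      by apply: leq_in_count => x _; rewrite colf_low // => /blow ->.
    apply: leq_trans h _; apply: leq_in_count => x xs bx; rewrite colf_high //.
    have := hasPn hn x xs; move: xs bx; rewrite (mem_segment wp) => /andP[xN _].
    by rewrite bij1 //; lia.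
exists i, m; split=> //; try by split=> //; lia.
split=> //; apply: (@dyck_interval_intro N w i m p) => //; try lia.
- by move=> x y h1 h2; apply: ordj; lia.
- by move=> x y h1 h2; apply: ordj1; lia.
rewrite -!map_drop !cnt_map -[w in drop _ w]take_size.
apply: (@leq_trans (e - x0)).
  apply: (@count_le _ _ (e + A).+1) => // z; rewrite (mem_segment wp) colf_high // => hz1 hz2.
  by have := hA z; lia.
apply: (@count_ge _ _ x0.+1) => z hz; rewrite colf_low // (mem_segment wp).
have zN : 0 < z <= N by lia.
by have := index_perm_lt wp zN; have := ordj x0 z; rewrite ip sw; lia.
Qed.

Theorem theorem4p37 (lam : seq nat) :
  is_partition lam ->
  [/\ (* phi is a bijection CS(lam)_l -> B(lam)_l on vertices *)
      (forall T, T \in CSvert lam -> phi T \in Bvert lam),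
      {in CSvert lam &, injective phi},
      (forall b, b \in Bvert lam -> exists2 T, T \in CSvert lam & phi T = b),
      (* every edge of the induced subgraph becomes the crystal edge with label j *)
      (forall T T' i m, T \in CSvert lam -> T' \in CSvert lam ->
         cs_edge T i m T' ->
         exists j, [/\ 0 < j < size lam,
                       {subset iota i m.+1 <= block (Des T) j},
                       {subset iota (i + m).+1 m <= block (Des T) j.+1} &
                       f_tab j (phi T) = Some (phi T')]) &
      (* every crystal edge of B(lam)_l comes from such an edge *)
      (forall T j b', T \in CSvert lam -> 0 < j < size lam ->
         f_tab j (phi T) = Some b' ->
         exists T' i m, [/\ T' \in CSvert lam, cs_edge T i m T', phi T' = b',
                           {subset iota i m.+1 <= block (Des T) j} &
                           {subset iota (i + m).+1 m <= block (Des T) j.+1}])].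
Proof.
move=> lam_part; have [s0|lam_gt0] := posnP (size lam).
  (* The empty partition has only the empty tableau as vertex, and no edges. *)
  have {s0} -> : lam = [::] by apply/eqP; rewrite -size_eq0 s0.
  have nilV T : T \in CSvert [::] -> T = [::].
    by rewrite inE /= => /andP[/and3P[/eqP]]; case: T.
  split=> //.
  - by move=> T /nilV ->.
  - by move=> T T' /nilV -> /nilV ->.
  - move=> b; rewrite inE /= => /and3P[/eqP sb _ _]; exists [::] => //.
    by case: b sb.
  - by move=> T T' i m /nilV -> _ [/and4P[/= h1 h2 h3]]; lia.
  - by move=> T j b' _ /=; lia.
have N_gt0 := sumn_partition_gt0 lam_part lam_gt0.
set N := sumn lam in N_gt0.
have blocks T i m j : is_SYT lam T -> 0 < i -> i + 2 * m <= N -> 0 < j ->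
    (forall x, i <= x <= i + m -> bi (rowword T) x = j) ->
    (forall x, i + m < x <= i + 2 * m -> bi (rowword T) x = j.+1) ->
    {subset iota i m.+1 <= block (Des T) j} /\
    {subset iota (i + m).+1 m <= block (Des T) j.+1}.
  move=> hT i0 imN j0 bl bh; split=> x; rewrite mem_iota => hx.
    rewrite -(prednK j0) (mem_block lam_part hT N_gt0); last by rewrite -/N; lia.
    by rewrite prednK // bl //; lia.
  rewrite (mem_block lam_part hT N_gt0); last by rewrite -/N; lia.
  by rewrite bh //; lia.
(* Both edge directions reduce to this: the collapsed word and [phi T] change at the same
   position [p] and have the same standardization. *)
have edge T i m j p : T \in CSvert lam -> 0 < i -> 0 < m -> i + 2 * m <= N -> 0 < j < size lam ->
    (forall x, i <= x <= i + m -> bi (rowword T) x = j) ->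
    (forall x, i + m < x <= i + 2 * m -> bi (rowword T) x = j.+1) ->
    p < N -> i <= nth 0 (rowword T) p <= i + m ->
    (forall y, i + 2 * m < y <= N -> bi (rowword T) y = j.+1 -> p < index y (rowword T)) ->
    rightmost_unbracketed i (map (colf i m) (rowword T)) p ->
    exists b c, [/\ f_tab j (phi T) = Some b, f_tab i (collapse i m T) = Some c,
                    std_tab b = std_tab c & b \in Bvert lam].
  move=> /[dup] /(phi_Bvert lam_part lam_gt0)/(BvertP lam_part)[_ vs vr] /(CSvertP lam_part lam_gt0)[hT hl].
  move=> i0 m0 imN hj bl bh hp hx ex unb; have wp := syt_perm hT.
  have sw := size_perm_iota wp.
  have unb' := uncollapse_unbracketed wp i0 m0 imN bl bh hp hx ex unb.
  have rphi := rowword_phi lam_part hT N_gt0.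
  have sphi := shape_phi hT.
  rewrite rphi in vs vr.
  have ssz g a : size (set_nth 0 (map g (rowword T)) p a) = sumn lam.
    by rewrite size_set_nth size_map sw -/N; lia.
  exists (tab_of_word lam (set_nth 0 (map (bi (rowword T)) (rowword T)) p j.+1)).
  exists (tab_of_word lam (set_nth 0 (map (colf i m) (rowword T)) p i.+1)).
  split.
  - by rewrite (@f_tabE _ _ p) ?rphi ?sphi.
  - have e1 : rowword (collapse i m T) = map (colf i m) (rowword T) by exact: rowword_map.
    by rewrite (@f_tabE _ _ p) e1 // shape_map (syt_shape hT).
  - rewrite /std_tab !shape_tab_of_word ?tab_of_wordK //.
    by rewrite (std_collapse wp i0 m0 imN bl bh hp hx ex).
  - apply: tab_Bvert => //; first by apply: ssyt_word_f => //; rewrite size_map sw.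
    by move=> q hq; rewrite nth_set_nth /=; case: eqP => // _; [lia | exact: vr].
split.
- exact: (phi_Bvert lam_part lam_gt0).
- move=> T T' hT hT' e.
  by rewrite -(std_phi lam_part lam_gt0 hT) e (std_phi lam_part lam_gt0 hT').
- move=> b /(std_tab_vert lam_part lam_gt0)[h1 h2]; by exists (std_tab b).
- move=> T T' i m hT hT' [hd [b hb eT']].
  have /(CSvertP lam_part lam_gt0)[sT bT] := hT.
  have /(CSvertP lam_part lam_gt0)[sT' bT'] := hT'.
  have wp := syt_perm sT; have sw := size_perm_iota wp.
  have dw := dyck_interval_desw wp hd; move: hd => /and4P[m0 i0 imN _].
  rewrite sw -/N in imN.
  set w := rowword T in bT wp sw dw imN.
  (* The sole descent within the window is [i + m], so the block index is constant on each half and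
     grows by one between them. *)
  have bl k : k <= m -> bi w (i + k) = bi w i.
    elim: k => [|k IHk] hk; first by rewrite addn0.
    by rewrite addnS biS ?dw ?IHk //; lia.
  have bh k : k < m -> bi w (i + m + k).+1 = (bi w i).+1.
    elim: k => [|k IHk] hk; rewrite biS ?dw; try lia.
      by rewrite addn0 bl // eqxx addn1.
    by rewrite addnS IHk; lia.
  have {}bl x : i <= x <= i + m -> bi w x = bi w i.
    by move=> hx; rewrite -(bl (x - i)); [congr bi|]; lia.
  have {}bh x : i + m < x <= i + 2 * m -> bi w x = (bi w i).+1.
    by move=> hx; rewrite -(bh (x - (i + m).+1)); [congr bi|]; lia.
  have hj : 0 < bi w i < size lam.
    rewrite bi_gt0 -bT -(bh (i + m).+1); last by lia.
    by apply: bi_homo; lia.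
  have e1 : rowword (collapse i m T) = map (colf i m) w by exact: rowword_map.
  have [p unb eb] := f_tabP hb; rewrite e1 in unb eb.
  have [hp cp _ _] := unb; rewrite size_map sw in hp.
  move: cp; rewrite (nth_map 0) ?sw // => /eqP; rewrite colf_low // => hx.
  have ssz : size (set_nth 0 (map (colf i m) w) p i.+1) = sumn lam.
    by rewrite size_set_nth size_map sw -/N; lia.
  have sc : Defs.shape (collapse i m T) = lam by rewrite shape_map (syt_shape sT).
  have rT' : rowword T' = std_word (set_nth 0 (map (colf i m) w) p i.+1).
    rewrite -eT' eb sc /std_tab shape_tab_of_word // !tab_of_wordK //.
    by rewrite size_std_word.
  (* Here the target being in the induced subgraph matters: [T] and [T'] have equally many blocks,
     so the edge creates no additional descent. *)
  have ex : forall y, i + 2 * m < y <= N -> bi w y = (bi w i).+1 -> p < index y w.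
    by apply: (extra_letters_after wp i0 m0 imN bl bh unb); rewrite -rT' -/N bT bT'.
  have [b' [c [h1 h2 h3 h4]]] := edge T i m _ p hT i0 m0 imN hj bl bh hp hx ex unb.
  have [bk1 bk2] := blocks T i m (bi w i) sT i0 imN isT bl bh.
  exists (bi w i); split=> //; rewrite h1; congr Some.
  move: h2; rewrite hb => -[e2]; rewrite -eT' e2 -h3.
  by have [_ ->] := std_tab_vert lam_part lam_gt0 h4.
- move=> T j b' hT hj hb.
  have /(CSvertP lam_part lam_gt0)[sT bT] := hT.
  have wp := syt_perm sT; have [p unb eb] := f_tabP hb.
  rewrite (rowword_phi lam_part sT N_gt0) in unb.
  have [i [m [[i0 m0 imN] bl bh [hp hx ex] [unb' dyck]]]] :=
    crystal_window lam_part erefl wp (syt_word lam_part sT) bT hj unb.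
  have [b [c [h1 h2 h3 h4]]] := edge T i m j p hT i0 m0 imN hj bl bh hp hx ex unb'.
  have j0 : 0 < j by lia.
  have [bk1 bk2] := blocks T i m j sT i0 imN j0 bl bh.
  have [g1 g2] := std_tab_vert lam_part lam_gt0 h4.
  have ebb : b' = b by move: h1; rewrite hb => -[].
  exists (std_tab b), i, m; split=> //; last by rewrite ebb.
  by split=> //; exists c.
Qed.
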